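(* For every prime number $p>0$ there exists a rational number $t_p$ such that $$t_p \in \mathrm{Accum}(\mathcal{T}_{2,p}) \setminus \mathcal{T}_{1,p}.$$
   Context: A ring $A$ of characteristic $p>0$ is $F$-finite if the Frobenius map $F: A\to A$ is a finite ring homomorphism. $F^e_*A$ denotes $A$ viewed as an $A$-module via the $e$-th iterate $F^e$ of Frobenius. For an $F$-finite regular local ring $A$ of characteristic $p$ and a non-zero principal ideal $(f)\subsetneq A$, the $F$-pure threshold $\mathrm{fpt}(A;(f))$ is the supremum of all real $s\ge 0$ for which there exist an integer $e>0$ and $\phi\in \mathrm{Hom}_A(F^e_*A,A)$ with $\phi(F^e_*(f^{\lceil s(p^e-1)\rceil}A))=A$. By convention $\mathrm{fpt}(A;(0))=0$. For an integer $d>0$, $\mathcal{T}_{d,p}\subseteq\mathbb{R}$ is the set of all values $\mathrm{fpt}(A;(f))$, where $A$ runs through all $F$-finite $d$-dimensional regular local rings of characteristic $p$ and $(f)\subsetneq A$ runs through all proper principal ideals of $A$. For $S\subseteq\mathbb{R}$, $\mathrm{Accum}(S)\subseteq \mathbb{R}$ is the set of all accumulation points of $S$, i.e. real numbers $t$ such that every neighbourhood of $t$ contains an element of $S$ different from $t$. *)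

(* Defs.v *)
From HB Require Import structures.
From mathcomp Require Import all_boot all_order all_algebra.
From mathcomp Require Import all_classical all_reals all_analysis.

Set Implicit Arguments.
Unset Strict Implicit.
Unset Printing Implicit Defensive.

Import Order.TTheory GRing.Theory Num.Theory.
Local Open Scope classical_set_scope.
Local Open Scope ring_scope.

Definition gen_submod (A : comNzRingType) (V : lmodType A) (s : seq V) : set V :=
  [set x | exists c : 'I_(size s) -> A, x = \sum_i c i *: s`_i].

Definition fin_gen (A : comNzRingType) (V : lmodType A) : Prop :=
  exists s : seq V, gen_submod s = setT.

Definition gen_ideal (A : comNzRingType) (s : seq A) : set A :=
  @gen_submod A A^o s.

(* [idealr_closed I] says that I is a proper ideal: it includes 1 \notin I.
   The unit ideal is generated by 1, so it may be left out here. *)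
Definition noetherian (A : comNzRingType) : Prop :=
  forall I : {pred A}, idealr_closed I ->
    exists s : seq A, [set` I] = gen_ideal s.

Definition maximal_ideal (A : comNzRingType) (M : {pred A}) : Prop :=
  idealr_closed M /\
  forall I : {pred A}, idealr_closed I -> {subset M <= I} -> I =i M.

Definition prime_ideal (A : comNzRingType) (P : {pred A}) : Prop :=
  idealr_closed P /\ prime_idealr_closed P.

(* P_0 < P_1 < ... < P_n: a chain of length n has n.+1 members. *)
Definition has_prime_chain (A : comNzRingType) (n : nat) : Prop :=
  exists P : nat -> {pred A},
    (forall i, (i <= n)%N -> prime_ideal (P i)) /\
    (forall i, (i < n)%N -> [set` P i] `<` [set` P i.+1]).

Definition krull_dim (A : comNzRingType) (d : nat) : Prop :=
  has_prime_chain A d /\ forall n, has_prime_chain A n -> (n <= d)%N.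

Definition regular_local (A : comNzRingType) (d : nat) : Prop :=
  [/\ noetherian A, krull_dim A d &
      exists M : {pred A},
        [/\ maximal_ideal M,
            forall N : {pred A}, maximal_ideal N -> N =i M &
            exists s : d.-tuple A, [set` M] = gen_ideal s]].

(* F^e_* A: the abelian group A, on which a acts as multiplication by F^e a. *)
Definition frob_push (p : nat) (A : comNzRingType) (chA : p \in [pchar A])
  (e : nat) : Type := A.

Section FrobPush.
Variables (p : nat) (A : comNzRingType) (chA : p \in [pchar A]) (e : nat).

HB.instance Definition _ := GRing.Zmodule.on (frob_push chA e).

Let scale (a : A) (x : frob_push chA e) : frob_push chA e :=
  iter e (pFrobenius_aut chA) a * (x : A).

Fact frob_push_scaleA a b x : scale a (scale b x) = scale (a * b) x.
Proof.
rewrite /scale [RHS]/=; have -> : iter e (pFrobenius_aut chA) (a * b) =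
  iter e (pFrobenius_aut chA) a * iter e (pFrobenius_aut chA) b.
  by elim: e => //= n ->; rewrite rmorphM.
by rewrite mulrA.
Qed.

Fact frob_push_scale1 : left_id 1 scale.
Proof.
move=> x; rewrite /scale.
have -> : iter e (pFrobenius_aut chA) 1 = 1.
  by elim: e => //= n ->; rewrite rmorph1.
exact: mul1r.
Qed.

Fact frob_push_scaleDr : right_distributive scale +%R.
Proof. by move=> a x y; exact: mulrDr. Qed.

Fact frob_push_scaleDl x : {morph scale^~ x : a b / a + b}.
Proof.
move=> a b; rewrite /scale.
have -> : iter e (pFrobenius_aut chA) (a + b) =
  iter e (pFrobenius_aut chA) a + iter e (pFrobenius_aut chA) b.
  by elim: e => //= n ->; rewrite rmorphD.
exact: mulrDl.
Qed.

HB.instance Definition _ := GRing.Zmodule_isLmodule.Build A (frob_push chA e)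
  frob_push_scaleA frob_push_scale1 frob_push_scaleDr frob_push_scaleDl.

Definition to_frob_push (x : A) : frob_push chA e := x.

Lemma frob_push_scaleE (a x : A) :
  a *: to_frob_push x = to_frob_push (a ^+ (p ^ e) * x).
Proof.
rewrite /to_frob_push; change (iter e (pFrobenius_aut chA) a * x = a ^+ (p ^ e) * x).
congr (_ * _); elim: e => [|n IHn]; first by rewrite expn0 expr1.
by rewrite iterS IHn pFrobenius_autE -exprM expnSr.
Qed.

End FrobPush.

Definition F_finite (p : nat) (A : comNzRingType) (chA : p \in [pchar A]) : Prop :=
  fin_gen (frob_push chA 1).

(* The absolute value only turns the integer ceiling, which is nonnegative
   for 0 <= s, into a natural number. *)
Definition fpt_exponent (R : realType) (p e : nat) (s : R) : nat :=
  `|Num.ceil (s * ((p ^ e)%:R - 1))|%N.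

Definition fpt (R : realType) (p : nat) (A : comNzRingType)
    (chA : p \in [pchar A]) (f : A) : R :=
  if f == 0 then 0 else
  sup [set s : R | 0 <= s /\
    exists (e : nat) (phi : {linear frob_push chA e -> A^o}), (0 < e)%N /\
      phi @` (to_frob_push chA e @` gen_ideal [:: f ^+ fpt_exponent p e s])
        = setT].

Definition fpt_set (R : realType) (d p : nat) : set R :=
  [set t | exists (A : comNzRingType) (chA : p \in [pchar A]) (f : A),
    [/\ F_finite chA, regular_local A d, gen_ideal [:: f] != setT &
        t = fpt R chA f]].

Arguments fpt_set : clear implicits.

(* Main.v *)
Require Import Defs.
From HB Require Import structures.
From mathcomp Require Import all_boot all_order all_algebra.
From mathcomp Require Import all_classical all_reals all_analysis.
From mathcomp Require Import cyclic finfield.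
From mathcomp Require Import zify ring lra.
Import numFieldNormedType.Exports.
Import Order.TTheory GRing.Theory Num.Theory.

(** Put [q = p ^ 3] and [m = 2 * p + 1]. The accumulation point is
    [c = (m + 1) / (m * q)], and it is approached from above by the thresholds
    of the plane curve germs [f = (x ^ l + z) * (x ^ m + z ^ N)] over the prime
    field, where [z = y ^ q], [l + m + 1 = q], and [N] tends to infinity.

    Modulo [z] the germ is [x ^ (q - 1)]. Hence, for a power [q'] of [p], the
    power [f ^ q'] is [x ^ ((q - 1) * q')] modulo [z ^ q' = y ^ (q * q')], and
    [f ^ (q' + a)] lies in [(x ^ (q * q'), y ^ (q * q'))] if and only if
    [f ^ a] lies in [(x ^ q', z ^ q')]. So the threshold of [f] is
    [(1 + c') / q], where [c'] is the limit of [a / q'] for the largest [a]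
    with [f ^ a] outside [(x ^ q', z ^ q')].
    - The factor [x ^ m + z ^ N] puts [f ^ a] inside this ideal as soon as
      [a / q' >= 1 / m + 1 / N], by [curve_pow_ideal]. So the threshold is at
      most [c + 1 / N].
    - When [q'] is [p] modulo [m], the exponent [a = (q' - p) / m + 1] is [1]
      modulo [p] and satisfies [m * a >= q']; nevertheless [f ^ a] is outside
      the ideal, because it contains the monomial
      [x ^ (m * (a - 1)) * z ^ (a + N)] with coefficient [a], by
      [coef_curve_pow]. This gives a threshold greater than [c].

    A regular local ring of dimension one is a discrete valuation ring, by
    [regular_local1_dvr], and the threshold of a unit times [t ^ n] is [1 / n],
    by [fpt_set1]. But [c = 1 / n] would make [m + 1 = 2 * (p + 1)] a divisor
    of [p ^ 3].

    Both computations compare splittings with membership in Frobenius powers.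
    A splitting along a power of [f] can be iterated, so that such memberships
    bound the threshold from above ([split_exponents_le]). For lower bounds
    one needs splittings: over a discrete valuation ring they come from the
    freeness of [F^e_* A] ([split_off]), and in the plane from the basis of
    monomials with exponents less than [p ^ e] ([plane_splitting]).

    The local ring of the plane at the origin is constructed inside the
    fraction field of [F_p[y][x]]. It is noetherian by the basis theorem of
    Hilbert, and its dimension is two because a prime that strictly contains a
    nonzero prime must contain [y] and then [x] ([prime_y], [prime_x]). *)

Set Implicit Arguments.
Unset Strict Implicit.
Unset Printing Implicit Defensive.

Local Open Scope classical_set_scope.
Local Open Scope ring_scope.

(** * Finitely generated submodules *)

Section GenSubmod.
Variables (A : comNzRingType) (V : lmodType A).
Implicit Types (s : seq V) (a : A) (v w : V).

Lemma gen_submod_nil v : gen_submod [::] v <-> v = 0.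
Proof.
split=> [[c ->]|->]; first by rewrite big_ord0.
by exists (fun=> 0); rewrite big_ord0.
Qed.

Lemma gen_submod_cons v s w :
  gen_submod (v :: s) w <->
  exists a, exists2 u, gen_submod s u & w = a *: v + u.
Proof.
split=> [[c ->]|[a [u [c ->] ->]]].
  rewrite big_ord_recl /=; exists (c ord0).
  by exists (\sum_(i < size s) c (lift ord0 i) *: s`_i) => //; exists (c \o lift ord0).
exists (fun i => oapp c a (unlift ord0 i)).
rewrite big_ord_recl /= unlift_none /=; congr (_ + _).
by apply: eq_bigr => i _; rewrite liftK.
Qed.

Lemma gen_submod0 s : gen_submod s 0.
Proof. by exists (fun=> 0); rewrite big1// => i _; rewrite scale0r. Qed.

Lemma gen_submod_lin s a v w :
  gen_submod s v -> gen_submod s w -> gen_submod s (a *: v + w).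
Proof.
move=> [c ->] [d ->]; exists (fun i => a * c i + d i).
rewrite scaler_sumr -big_split /=; apply: eq_bigr => i _.
by rewrite scalerDl scalerA.
Qed.

Lemma gen_submodZ s a v : gen_submod s v -> gen_submod s (a *: v).
Proof. by move=> sv; rewrite -[_ *: _]addr0; apply: gen_submod_lin (gen_submod0 s). Qed.

Lemma gen_submodD s v w :
  gen_submod s v -> gen_submod s w -> gen_submod s (v + w).
Proof. by move=> sv sw; rewrite -[v]scale1r; apply: gen_submod_lin. Qed.

Lemma gen_submod_mem s v : v \in s -> gen_submod s v.
Proof.
elim: s => // w s IHs; rewrite inE => /predU1P[->|/IHs sv].
  by apply/gen_submod_cons; exists 1, 0; [exact: gen_submod0|rewrite scale1r addr0].
by apply/gen_submod_cons; exists 0, v; rewrite // scale0r add0r.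
Qed.

Lemma gen_submod_min s (W : set V) :
  W 0 -> (forall a v w, W v -> W w -> W (a *: v + w)) ->
  (forall v, v \in s -> W v) -> gen_submod s `<=` W.
Proof.
move=> W0 Wlin; elim: s => [|v s IHs] sW w; first by move/gen_submod_nil->.
move/gen_submod_cons => [a [u su ->]]; apply: Wlin; first exact/sW/mem_head.
by apply: IHs su => x xs; apply: sW; rewrite inE xs orbT.
Qed.

Lemma gen_submod_trans s s' :
  (forall v, v \in s -> gen_submod s' v) -> gen_submod s `<=` gen_submod s'.
Proof.
by apply: gen_submod_min (gen_submod0 s') _ => a v w; apply: gen_submod_lin.
Qed.

End GenSubmod.

Lemma set_in (T : Type) (I : set T) : [set` [in I] : {pred T}] = I.
Proof. exact: (set_mem_set I). Qed.

Section Ideals.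
Variable A : comNzRingType.
Implicit Types (a u v : A) (I : set A) (s : seq A).

Lemma gen_idealP v s u :
  gen_ideal (v :: s) u <-> exists a, exists2 w, gen_ideal s w & u = a * v + w.
Proof. exact: (@gen_submod_cons A A^o). Qed.

Lemma gen_ideal1P v u : gen_ideal [:: v] u <-> exists a, u = a * v.
Proof.
split=> [/gen_idealP[a [w /(@gen_submod_nil A A^o)-> ->]]|[a ->]].
  by exists a; rewrite addr0.
by apply/gen_idealP; exists a, 0; rewrite ?addr0//; apply/(@gen_submod_nil A A^o).
Qed.

Lemma gen_ideal2P v w u :
  gen_ideal [:: v; w] u <-> exists a b, u = a * v + b * w.
Proof.
split=> [/gen_idealP[a [x /gen_ideal1P[b ->] ->]]|[a [b ->]]]; first by exists a, b.
by apply/gen_idealP; exists a, (b * w) => //; apply/gen_ideal1P; exists b.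
Qed.

Definition is_ideal I := I 0 /\ forall a u v, I u -> I v -> I (a * u + v).

Lemma is_idealD I u v : is_ideal I -> I u -> I v -> I (u + v).
Proof. by move=> [_ Ilin] Iu Iv; rewrite -[u]mul1r; apply: Ilin. Qed.

Lemma is_idealM I a u : is_ideal I -> I u -> I (a * u).
Proof. by move=> [I0 Ilin] Iu; rewrite -[_ * _]addr0; apply: Ilin. Qed.

Lemma gen_ideal_is_ideal s : is_ideal (gen_ideal s).
Proof. by split; [exact: gen_submod0|move=> a u v; exact: gen_submod_lin]. Qed.

Lemma gen_ideal_trans s s' :
  (forall v, v \in s -> gen_ideal s' v) -> gen_ideal s `<=` gen_ideal s'.
Proof. exact: (@gen_submod_trans A A^o). Qed.

Lemma gen_ideal_mem s v : v \in s -> gen_ideal s v.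
Proof. exact: (@gen_submod_mem A A^o). Qed.

Lemma gen_ideal_min s I :
  is_ideal I -> (forall v, v \in s -> I v) -> gen_ideal s `<=` I.
Proof. by move=> [I0 Ilin]; apply: (@gen_submod_min A A^o). Qed.

Lemma gen_ideal_unit v : (exists w, w * v = 1) <-> gen_ideal [:: v] = setT.
Proof.
split=> [[w wv]|vT]; last first.
  have /gen_ideal1P[w] : gen_ideal [:: v] 1 by rewrite vT.
  by exists w.
by rewrite -subTset => u _; apply/gen_ideal1P; exists (u * w); rewrite -mulrA wv mulr1.
Qed.

Lemma idealr_closedP (P : {pred A}) :
  idealr_closed P <-> is_ideal [set` P] /\ ~ [set` P] 1.
Proof.
split=> [[P0 P1 Plin]|[[P0 Plin] P1]].
  by split; [split=> [|a u v]; [exact: P0|exact: Plin]|exact/negP].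
by split; [exact: P0|exact/negP|move=> a u v; exact: Plin].
Qed.

End Ideals.

(** * Noetherian rings *)

Section Noetherian.
Variable A : comNzRingType.

Definition ideals_fin_gen : Prop :=
  forall I : set A, is_ideal I -> exists s : seq A, I = gen_ideal s.

Lemma dependent_choice_seq (T : Type) (P : seq T -> T -> Prop) :
  (forall s, exists x, P s x) -> exists a : nat -> T, forall n, P (mkseq a n) (a n).
Proof.
move=> /choice[F FP]; pose pre n := iter n (fun s => rcons s (F s)) [::].
exists (fun n => F (pre n)) => n; suff -> : mkseq (fun n => F (pre n)) n = pre n by [].
by elim: n => // n IHn; rewrite mkseqS IHn.
Qed.

Lemma noetherian_seq (a : nat -> A) :
  noetherian A -> exists N, gen_ideal (mkseq a N) (a N).
Proof.
move=> noethA; pose I := [set x | exists N, gen_ideal (mkseq a N) x].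
have sub m n : (m <= n)%N -> gen_ideal (mkseq a m) `<=` gen_ideal (mkseq a n).
  move=> mn; apply: gen_ideal_trans => v /mapP[i]; rewrite mem_iota => im ->.
  by apply/gen_ideal_mem/map_f; rewrite mem_iota; lia.
have I_ideal : is_ideal I.
  split=> [|c u v [m um] [n vn]]; first by exists 0%N; case: (gen_ideal_is_ideal (mkseq a 0)).
  exists (maxn m n); apply: (gen_ideal_is_ideal _).2; [apply: sub um|apply: sub vn];
    by rewrite ?leq_maxl ?leq_maxr.
have [[N N1]|I1] := pselect (I 1).
  exists N; rewrite -[a N]mulr1.
  exact: is_idealM (gen_ideal_is_ideal _) N1.
have /noethA[s] : idealr_closed ([in I] : {pred A}).
  by apply/idealr_closedP; rewrite set_in.
rewrite set_in => Is.
have [N sN] : exists N, forall v, v \in s -> gen_ideal (mkseq a N) v.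
  have: forall v, v \in s -> I v by move=> v vs; rewrite Is; apply: gen_ideal_mem.
  elim: s {Is} => [|v s IHs] sI; first by exists 0%N.
  have [N1 N1v] := sI v (mem_head _ _).
  have [|N2 N2s] := IHs; first by move=> w ws; apply: sI; rewrite inE ws orbT.
  exists (maxn N1 N2) => w; rewrite inE => /predU1P[->|/N2s].
    exact: sub (leq_maxl _ _) _ N1v.
  exact: sub (leq_maxr _ _) _.
exists N; apply: (gen_ideal_trans sN).
have : I (a N) by exists N.+1; apply/gen_ideal_mem/map_f; rewrite mem_iota; lia.
by rewrite Is.
Qed.

Lemma ideals_fin_gen_noetherian : ideals_fin_gen -> noetherian A.
Proof. by move=> fgA P /idealr_closedP[/fgA]. Qed.

(** Repeated division of an element of [S] by [t] gives [w n = t * w n.+1].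
    The ideals generated by the first [n] quotients increase, so they stop at
    some [w N = c * t * w N], and this is [0] when no [1 - c * t] is a zero
    divisor. In a local ring with [t] in the maximal ideal this replaces both
    the Krull intersection theorem and the lemma of Nakayama. *)
Lemma noetherian_infinitely_divisible (t : A) (S : set A) :
    noetherian A -> (forall c x, (1 - c * t) * x = 0 -> x = 0) ->
    (forall z, S z -> exists2 w, S w & z = t * w) ->
  forall z, S z -> z = 0.
Proof.
move=> noethA reg Sdiv z Sz.
have /choice[F FP] x : exists y, S x -> S y /\ x = t * y.
  by have [/Sdiv[y Sy ->]|nSx] := pselect (S x); [exists y|exists 0].
pose w n := iter n F z.
have Sw n : S (w n) by elim: n => // n /FP[].
have wS n : w n = t * w n.+1 by have [] := FP _ (Sw n).
have [N wN] := noetherian_seq w noethA.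
have w0 n : w n = 0 -> z = 0 by elim: n => // n IHn wn; apply: IHn; rewrite wS wn mulr0.
apply: (w0 N); suff [c wNE] : exists c, w N = c * t * w N.
  by apply: (reg c); rewrite mulrBl mul1r -wNE subrr.
apply: (gen_ideal_min (I := [set x | exists c, x = c * t * w N]) _ _ wN).
  split=> [|a u v [c ->] [d ->]]; first by exists 0; rewrite !mul0r.
  by exists (a * c + d); ring.
move=> v /mapP[i]; rewrite mem_iota /= add0n => iN ->.
have wE k : exists c, w i = c * w (k + i)%N.
  elim: k => [|k [c cE]]; first by exists 1; rewrite mul1r.
  by exists (c * t); rewrite cE wS addSn mulrA.
have [c ->] := wE (N.-1 - i)%N; exists c.
rewrite subnK; last lia.
by rewrite -mulrA wS prednK //; lia.
Qed.

(** Choosing at each stage an element of least degree outside the ideal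
    generated so far gives a sequence whose leading coefficients do not
    generate an increasing chain for ever: at some stage the leading term is
    cancelled by earlier elements, against the minimality of the degree. *)
Theorem Hilbert_basis (I : set {poly A}) :
  noetherian A -> is_ideal I -> exists s, I = gen_ideal s.
Proof.
move=> noethA I_ideal; apply: contrapT => not_fg.
pose P (s : seq {poly A}) f := (forall v, v \in s -> I v) ->
  [/\ I f, ~ gen_ideal s f &
      forall g, I g -> ~ gen_ideal s g -> (size f <= size g)%N].
have /dependent_choice_seq[a aP] : forall s, exists f, P s f.
  move=> s; have [sI|] := pselect (forall v, v \in s -> I v); last by exists 0.
  have [g Ig gs] : exists2 g, I g & ~ gen_ideal s g.
    apply: contrapT => none; apply: not_fg; exists s; apply/seteqP; split.
      by move=> x Ix; apply: contrapT => xs; apply: none; exists x.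
    exact: gen_ideal_min.
  pose Q n := `[< exists f, [/\ I f, ~ gen_ideal s f & size f = n] >].
  have exQ : exists n, Q n by exists (size g); apply/asboolP; exists g.
  case: (ex_minnP exQ) => n /asboolP[f [If fs sf]] nmin.
  exists f => _; split=> // h Ih hs; rewrite sf; apply: nmin.
  by apply/asboolP; exists h.
have aI n : I (a n).
  elim/ltn_ind: n => n IHn; have [] // := aP n.
  by move=> v /mapP[i]; rewrite mem_iota /= => iN ->; apply: IHn.
have prefI n v : v \in mkseq a n -> I v by move=> /mapP[i _ ->].
have szle i j : (i <= j)%N -> (size (a i) <= size (a j))%N.
  move=> ij; have [_ _ ->//] := aP i (prefI i).
  have [_ + _] := aP j (prefI j); apply: contra_not.
  apply: gen_ideal_trans => v /mapP[k]; rewrite mem_iota => ki ->.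
  by apply/gen_ideal_mem/map_f; rewrite mem_iota; lia.
have [N leadN] := noetherian_seq (lead_coef \o a) noethA.
have [_ aN minN] := aP N (prefI N); pose n := (size (a N)).-1.
have szN : size (a N) = n.+1.
  rewrite /n prednK // lt0n size_poly_eq0; apply/eqP => aN0; apply: aN.
  by rewrite aN0; exact: (gen_ideal_is_ideal _).1.
(* an ideal element of prescribed degree realizes each combination of the
   leading coefficients *)
have combine (s : seq {poly A}) c : (forall v, v \in s -> (size v <= n.+1)%N) ->
    gen_ideal (map lead_coef s) c ->
    exists h, [/\ gen_ideal s h, (size h <= n.+1)%N & h`_n = c].
  elim: s c => [|v s IHs] c szs.
    move=> /(@gen_submod_nil A A^o)->; exists 0.
    by split; [exact: (gen_ideal_is_ideal _).1|rewrite size_poly0|rewrite coef0].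
  move=> /gen_idealP[b [d ds ->]].
  have [|h [hs szh hn]] := IHs d _ ds; first by move=> w ws; apply: szs; rewrite inE ws orbT.
  have szv := szs v (mem_head _ _).
  exists (b *: 'X^(n - (size v).-1) * v + h); split.
  - by apply/gen_idealP; exists (b *: 'X^(n - (size v).-1)), h.
  - rewrite (leq_trans (size_polyD _ _)) // geq_max szh andbT -scalerAl.
    rewrite (leq_trans (size_scale_leq _ _)) //.
    have [->|v0] := eqVneq v 0; first by rewrite mulr0 size_poly0.
    by rewrite mulrC size_mulXn //; move: v0; rewrite -size_poly_eq0; lia.
  - rewrite coefD hn -scalerAl coefZ coefXnM ltnNge leq_subr /=.
    by rewrite subKn //; move: szv; case: (size v).
have sza v : v \in mkseq a N -> (size v <= n.+1)%N.
  by move=> /mapP[i]; rewrite mem_iota /= => iN ->; rewrite -szN; apply: szle; lia.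
have lead_a : gen_ideal (map lead_coef (mkseq a N)) (lead_coef (a N)).
  by rewrite /mkseq -map_comp.
have [h [hs szh hn]] := combine _ _ sza lead_a.
have /minN/(_ _) : I (a N - h).
  rewrite addrC -mulN1r; apply: I_ideal.2 => //.
  exact: (gen_ideal_min I_ideal (prefI N)) hs.
rewrite szN leqNgt ltnS => /(_ _)/negP; apply.
  move=> bad; apply: aN; rewrite -(subrK h (a N)).
  exact: is_idealD (gen_ideal_is_ideal _) _ _.
apply/leq_sizeP => j; rewrite leq_eqVlt => /predU1P[<-|nj]; rewrite coefB.
  by rewrite hn lead_coefE szN subrr.
by rewrite (nth_default _ (leq_trans szh nj)) nth_default ?subr0 ?szN.
Qed.

End Noetherian.

(** * Frobenius splittings along powers of an element *)

(** The [A]-linear maps from [F^e_* A] to [A], seen as maps on [A] itself. *)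
Definition frob_linear (p e : nat) (A : comNzRingType) (psi : A -> A) : Prop :=
  forall z u v, psi (z ^+ (p ^ e) * u + v) = z * psi u + psi v.

Section FrobLinear.
Variables (p e : nat) (A : comNzRingType) (psi : A -> A).
Hypothesis psi_lin : frob_linear p e psi.

Lemma frob_linear0 : psi 0 = 0.
Proof.
have := psi_lin 1 0 0; rewrite mulr0 addr0 mul1r => /eqP.
by rewrite addrC -subr_eq subrr eq_sym => /eqP.
Qed.

Lemma frob_linearD u v : psi (u + v) = psi u + psi v.
Proof. by have := psi_lin 1 u v; rewrite expr1n !mul1r. Qed.

Lemma frob_linearM z u : psi (z ^+ (p ^ e) * u) = z * psi u.
Proof. by rewrite -[_ * u]addr0 psi_lin frob_linear0 addr0. Qed.

Lemma frob_linear_iter k : frob_linear p (e * k) (iter k psi).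
Proof.
elim: k => [|k IHk] z u v; first by rewrite muln0 expn0 expr1.
by rewrite mulnS expnD exprM /= IHk psi_lin.
Qed.

End FrobLinear.

(** The real numbers whose supremum is the F-pure threshold. A linear map that
    sends the ideal of [f ^+ a] onto [A] can be premultiplied so that it sends
    [f ^+ a] itself to [1]. *)
Definition split_exponents (R : realType) (p : nat) (A : comNzRingType) (f : A) : set R :=
  [set s | 0 <= s /\ exists e (psi : A -> A),
    [/\ (0 < e)%N, frob_linear p e psi & psi (f ^+ fpt_exponent p e s) = 1]].

Arguments split_exponents R p {A} f _ : rename.

Lemma fptE (R : realType) (p : nat) (A : comNzRingType) (chA : p \in [pchar A]) (f : A) :
  f != 0 -> fpt R chA f = sup (split_exponents R p f).
Proof.
move=> f0; rewrite /fpt (negbTE f0); congr sup; apply/seteqP; split=> s /= [s0].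
  move=> [e [phi [e0 phiT]]]; split=> //.
  have [_ [_ /gen_ideal1P[c ->] <-] phi1] : (phi @` (to_frob_push chA e @`
      gen_ideal [:: f ^+ fpt_exponent p e s])) 1 by rewrite phiT.
  exists e, (fun x => phi (to_frob_push chA e (c * x))); split=> // z u v.
  rewrite -[_ * phi _]/(z *: (phi _ : A^o)) -linearP; congr (phi _).
  by rewrite frob_push_scaleE /to_frob_push mulrDr mulrCA.
move=> [e [psi [e0 psi_lin psi1]]]; split=> //.
have lin : linear (psi : frob_push chA e -> A^o).
  move=> z u v; rewrite -[u]/(to_frob_push chA e u) frob_push_scaleE; exact: psi_lin.
pose phi : {linear frob_push chA e -> A^o} :=
  HB.pack (psi : frob_push chA e -> A^o)
    (GRing.isLinear.Build A (frob_push chA e) A^o *:%R _ lin).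
exists e, phi; split=> //; rewrite -subTset => b _.
exists (to_frob_push chA e (b ^+ (p ^ e) * f ^+ fpt_exponent p e s)).
  exists (b ^+ (p ^ e) * f ^+ fpt_exponent p e s) => //.
  by apply/gen_ideal1P; exists (b ^+ (p ^ e)).
by rewrite /= /to_frob_push (frob_linearM psi_lin) psi1 mulr1.
Qed.

(** Frobenius-linear maps send the Frobenius power of an ideal into the ideal,
    so when the ideal is proper its Frobenius power contains no [f ^+ a] along
    which there is a splitting. *)
Lemma frob_linear_gen_ideal p e (A : comNzRingType) (psi : A -> A) (s : seq A) u :
  frob_linear p e psi -> gen_ideal [seq x ^+ (p ^ e) | x <- s] u -> gen_ideal s (psi u).
Proof.
move=> psi_lin su; rewrite -[u]mul1r; move: (1 : A); move: u su.
have sP := gen_ideal_is_ideal s.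
apply: (gen_ideal_min (I := [set u | forall c, gen_ideal s (psi (c * u))])).
  split=> [c|a u v su sv c]; first by rewrite mulr0 (frob_linear0 psi_lin); case: sP.
  by rewrite mulrDr mulrA (frob_linearD psi_lin); apply: is_idealD.
move=> _ /mapP[x xs ->] c; rewrite mulrC (frob_linearM psi_lin) mulrC.
exact/(is_idealM _ sP)/gen_ideal_mem.
Qed.

Lemma frob_linear_iter_split p e (A : comNzRingType) (psi : A -> A) (f : A) a k :
    frob_linear p e psi -> psi (f ^+ a) = 1 ->
  iter k psi (f ^+ (a * \sum_(i < k) (p ^ e) ^ i)) = 1.
Proof.
move=> psi_lin psi1; elim: k => [|k IHk]; first by rewrite big_ord0 muln0.
rewrite iterSr -[RHS]IHk; congr iter; rewrite big_ord_recl mulnDr muln1 exprD mulrC.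
under eq_bigr do rewrite expnS; rewrite -big_distrr /= mulnCA mulnC exprM.
by rewrite (frob_linearM psi_lin) psi1 mulr1.
Qed.

Section FptBounds.
Variables (R : realType) (p : nat).
Hypothesis p1 : (1 < p)%N.

Let q_gt1 e : (0 < e)%N -> 1 < (p ^ e)%:R :> R.
Proof. by move=> e0; rewrite ltr1n -(expn0 p) ltn_exp2l. Qed.

Lemma split_exponents_mem (A : comNzRingType) (psi : A -> A) (f : A) a e :
    (0 < e)%N -> frob_linear p e psi -> psi (f ^+ a) = 1 ->
  split_exponents R p f (a%:R / ((p ^ e)%:R - 1)).
Proof.
move=> e0 psi_lin psi1; have := q_gt1 e0; rewrite -subr_gt0 => q0.
split; first by rewrite divr_ge0// ltW.
exists e, psi; split=> //.
by rewrite /fpt_exponent divfK ?gt_eqF// -[a%:R]/(a%:~R : R) intrKceil.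
Qed.

(** Iterating a splitting along [f ^+ a] splits off [f ^+ N] for
    [N = a * (1 + q + ... + q ^ (k - 1))], and [N / q ^ k] tends to
    [a / (q - 1)]; so membership of powers of [f] in Frobenius powers of a
    proper ideal is needed only for large exponents. *)
Lemma split_exponents_le (A : comNzRingType) (s : seq A) (f : A) (B : R) (E0 : nat) :
    ~ gen_ideal s 1 ->
    (forall E N, (E0 <= E)%N -> B * (p ^ E)%:R <= N%:R ->
       gen_ideal [seq x ^+ (p ^ E) | x <- s] (f ^+ N)) ->
  ubound (split_exponents R p f) B.
Proof.
move=> s1 fs t [t0 [e [psi [e0 psi_lin psi1]]]]; rewrite leNgt; apply/negP => Bt.
set a := fpt_exponent p e t in psi1; have q1 := q_gt1 e0.
have ta : t * ((p ^ e)%:R - 1) <= a%:R.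
  rewrite /a /fpt_exponent natr_absz ger0_norm ?ceil_ge //.
  rewrite ceil_ge0; apply: lt_le_trans (ltrN10 _) _.
  by rewrite mulr_ge0// subr_ge0 ltW.
pose k := maxn E0 (Num.bound (t / (t - B))).
have kq : (k <= (p ^ e) ^ k)%N.
  by apply/ltnW/ltn_expl; rewrite -(ltr1n R).
have tk : t <= (t - B) * ((p ^ e) ^ k)%:R.
  rewrite mulrC -ler_pdivrMr ?subr_gt0//.
  apply: (@le_trans _ _ k%:R); last by rewrite ler_nat.
  have tB : 0 <= t / (t - B) by rewrite divr_ge0// subr_ge0 ltW.
  by rewrite (le_trans (ltW (archi_boundP tB)))// ler_nat leq_maxr.
apply: s1; rewrite -(frob_linear_iter_split k psi_lin psi1).
apply: (frob_linear_gen_ideal (frob_linear_iter psi_lin k)).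
apply: fs; first exact: leq_trans (leq_maxl E0 _) (leq_pmull _ e0).
have -> : ((a * \sum_(i < k) (p ^ e) ^ i)%N%:R : R) =
    a%:R * ((((p ^ e) ^ k)%:R - 1) / ((p ^ e)%:R - 1)).
  rewrite natrM; congr (_ * _); apply: (canRL (mulfK _)).
    by rewrite gt_eqF// subr_gt0.
  move: (p ^ e)%N => q; rewrite natr_sum natrX subrX1 mulrC; congr (_ * _).
  by apply: eq_bigr => i _; rewrite natrX.
have Q1 : 1 <= ((p ^ e) ^ k)%:R :> R by rewrite ler1n !expn_gt0 ltnW.
rewrite expnM [leRHS]mulrA [leRHS]mulrAC.
move: tk Q1; set Q := (_ ^ k)%:R => tk Q1.
apply: (@le_trans _ _ (t * (Q - 1))); first lra.
by rewrite ler_wpM2r ?subr_ge0// ler_pdivlMr ?subr_gt0.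
Qed.

End FptBounds.

(** * Regular local rings of dimension one *)

Lemma exists_maximal_ideal (A : comNzRingType) (I : set A) :
  is_ideal I -> ~ I 1 -> exists2 M : {pred A}, maximal_ideal M & I `<=` [set` M].
Proof.
move=> I_ideal I1; pose P (J : set A) := is_ideal (I `|` J) /\ ~ (I `|` J) 1.
have [F FP totF|M [[M_ideal M1] Mmax]] := @Zorn_bigcup A P.
  split; last first.
    by move=> [//|[X FX X1]]; have [_] := FP _ FX; apply; right.
  have union X u : F X -> (I `|` X) u -> (I `|` \bigcup_(X in F) X) u.
    by move=> FX [Iu|Xu]; [left|right; exists X].
  have lin X a u v : F X -> (I `|` X) u -> (I `|` X) v ->
      (I `|` \bigcup_(X in F) X) (a * u + v).
    by move=> FX Xu Xv; apply: (union X) => //; apply: (FP _ FX).1.2.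
  split=> [|a u v]; first by left; case: I_ideal.
  move=> [Iu|[X FX Xu]] [Iv|[Y FY Yv]].
  - by left; apply: I_ideal.2.
  - by apply: (lin Y) => //; [left|right].
  - by apply: (lin X) => //; [right|left].
  - by have [XY|YX] := totF _ _ FX FY; [apply: (lin Y)|apply: (lin X)] => //; right; auto.
exists [in I `|` M]; last by rewrite set_in => x Ix; left.
split; first by apply/idealr_closedP; rewrite set_in.
move=> J /idealr_closedP[J_ideal J1] MJ x; apply/idP/idP => [xJ|/MJ//].
apply: contrapT => xM; apply: (Mmax [set` J]).
  split=> [y My|JM]; first by apply/MJ/mem_set; right.
  by apply: xM; apply/mem_set; right; apply: JM.
suff IJ : I `|` [set` J] = [set` J] by rewrite /P IJ.
by apply/seteqP; split=> [y [Iy|//]|y Jy]; [apply/MJ/mem_set; left|right].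
Qed.

(** A nonunit generates a proper ideal, which lies in the only maximal one. *)
Lemma local_unit (A : comNzRingType) (M : {pred A}) (x : A) :
    (forall N : {pred A}, maximal_ideal N -> N =i M) ->
  x \notin M -> exists y, y * x = 1.
Proof.
move=> Muniq xM; apply: contrapT => xU.
have [|N Nmax xN] := exists_maximal_ideal (gen_ideal_is_ideal [:: x]).
  by move=> /gen_ideal1P[y yx]; apply: xU; exists y.
by move: xM; rewrite -(Muniq _ Nmax) => /negP; apply; apply/xN/gen_ideal_mem/mem_head.
Qed.

(** The prime [P 0] that lies strictly below another one does not contain the
    uniformizer [t]; hence [P 0 = t * P 0], which forces [P 0 = 0]: so the
    ring is a domain, in which every nonzero element is divisible by a highest
    power of [t]. *)
Lemma regular_local1_dvr (A : comNzRingType) : regular_local A 1 ->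
  exists t : A, [/\ ~ gen_ideal [:: t] 1,
    forall a b : A, a * b = 0 -> a = 0 \/ b = 0 &
    forall f : A, f != 0 -> exists n u v, v * u = 1 /\ f = u * t ^+ n].
Proof.
move=> [noethA [[P [Pprime Plt]] _] [M [Mmax Muniq [s Ms]]]].
have [t st] : exists t, s = [:: t] :> seq A.
  by case: s {Ms} => -[|t []]//= _; exists t.
rewrite st in Ms; have /idealr_closedP[M_ideal M1] := Mmax.1.
have MP x : x \in M -> exists y, x = y * t.
  by move=> xM; apply/gen_ideal1P; rewrite -Ms.
have tM : t \in M by have := gen_ideal_mem (mem_head t [::]); rewrite -Ms.
have reg c x : (1 - c * t) * x = 0 -> x = 0.
  have [|y y1] := @local_unit A M (1 - c * t) Muniq.
    apply/negP => ctM; apply: M1; rewrite -(subrK (c * t) 1).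
    by apply: is_idealD => //; apply: is_idealM.
  by move=> /(congr1 ( *%R y)); rewrite mulrA y1 mul1r mulr0.
have primeM i x : (i <= 1)%N -> x \in P i -> x \in M.
  move=> /Pprime[/idealr_closedP[P_ideal P1] _] xP.
  apply: contrapT => /negP/(local_unit Muniq)[y yx]; apply: P1.
  by rewrite -yx; apply: is_idealM.
have [/idealr_closedP[P0_ideal P01] P0prime] := Pprime 0 (leqnSn _).
have tP0 : t \notin P 0.
  apply/negP => tP; have [_] := Plt 0 (ltnSn _); apply=> x /primeM/MP[//|y ->].
  exact: is_idealM.
have P00 : forall x, x \in P 0 -> x = 0.
  apply: (noetherian_infinitely_divisible (t := t)) => // z zP.
  have [w zw] := MP _ (primeM _ _ (leqnSn _) zP); exists w; last by rewrite zw mulrC.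
  by move: zP; rewrite zw => /P0prime /orP[//|]; rewrite (negPf tP0).
have domA (a b : A) : a * b = 0 -> a = 0 \/ b = 0.
  move=> ab; have : a * b \in P 0 by rewrite ab; case: P0_ideal.
  by move=> /P0prime/orP[]/P00; [left|right].
exists t; split=> //; first by rewrite -Ms.
move=> f f0; apply: contrapT => nf; move: f0 => /eqP; apply.
apply: (noetherian_infinitely_divisible (t := t)
  (S := [set f | ~ exists n u v, v * u = 1 /\ f = u * t ^+ n])) => // z nz.
have /MP[w zw] : z \in M.
  apply: contrapT => /negP/(local_unit Muniq)[y yz]; apply: nz.
  by exists 0, z, y; rewrite expr0 mulr1.
exists w; last by rewrite zw mulrC.
apply: contra_not nz => -[n [u [v [vu wE]]]].
by exists n.+1, u, v; rewrite zw wE exprSr mulrA.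
Qed.

(** * Splitting elements off a finitely generated torsion-free module *)

Section TorsionFree.
Variables (A : comNzRingType) (t : A) (V : lmodType A).
Hypothesis valuation : forall f : A, f != 0 ->
  exists n u v, v * u = 1 /\ f = u * t ^+ n.
Hypothesis t_neq0 : t != 0.
Hypothesis torsion_free : forall (a : A) (v : V), a *: v = 0 -> a = 0 \/ v = 0.

Let divisible_or_unit a : (exists b, a = t * b) \/ exists b, b * a = 1.
Proof.
have [->|/valuation[[|n] [u [v [vu ->]]]]] := eqVneq a 0.
- by left; exists 0; rewrite mulr0.
- by right; exists v; rewrite expr0 mulr1.
- by left; exists (u * t ^+ n); rewrite exprS mulrCA.
Qed.

(** A combination of [s] is divisible by [t], or one of its coefficients is a
    unit and the corresponding generator can be traded for it. *)
Lemma divisible_or_exchange (s : seq V) w : gen_submod s w ->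
  (exists2 v, gen_submod s v & w = t *: v) \/
  (exists2 y, y \in s & gen_submod (w :: rem y s) y).
Proof.
elim: s w => [|y s IHs] w.
  by move=> /gen_submod_nil->; left; exists 0; [exact: gen_submod0|rewrite scaler0].
move=> /gen_submod_cons[a [w' sw' ->]].
have [[b ->]|[b ba]] := divisible_or_unit a; last first.
  right; exists y; rewrite ?mem_head //= eqxx; apply/gen_submod_cons.
  exists b, (- b *: w'); first exact: gen_submodZ.
  by rewrite scalerDr scalerA ba scale1r scaleNr addrK.
have [[v sv ->]|[y' y's gy']] := IHs _ sw'.
  left; exists (b *: y + v); last by rewrite scalerDr scalerA.
  by apply/gen_submod_cons; exists b, v.
right; exists y'; first by rewrite inE y's orbT.
rewrite /=; case: (eqVneq y y') => [->|_].
  by apply/gen_submod_cons; exists 0, y'; rewrite ?scale0r ?add0r//; apply: gen_submod_mem.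
apply: gen_submod_trans gy' => z; rewrite inE => /predU1P[->|zs]; last first.
  by apply: gen_submod_mem; rewrite !inE zs !orbT.
apply/gen_submod_cons; exists 1, (- (t * b) *: y); last by rewrite scale1r addrC scaleNr addKr.
by apply/gen_submodZ/gen_submod_mem/mem_head.
Qed.

Lemma exchange_or_divisible (s : seq V) x a : gen_submod s (a *: x) -> a != 0 ->
  (exists v, x = t *: v) \/
  (exists2 y, y \in s & gen_submod (x :: rem y s) y).
Proof.
move=> sx /valuation[n [u [v [vu aE]]]]; move: sx; rewrite {}aE.
elim: n => [|n IHn] sx.
all: have [[w sw xw]|[y ys gy]] := divisible_or_exchange sx; last first.
1,3: right; exists y => //; apply: gen_submod_trans gy => z; rewrite inE => /predU1P[->|zs];
  [by apply/gen_submodZ/gen_submod_mem/mem_head|by apply: gen_submod_mem; rewrite inE zs orbT].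
  left; exists (v *: w); move: xw; rewrite expr0 mulr1 => /(congr1 ( *:%R v)).
  by rewrite !scalerA vu scale1r mulrC.
apply: IHn; suff -> : (u * t ^+ n) *: x = w by [].
apply/eqP; rewrite -subr_eq0; apply/eqP.
have [||//] := @torsion_free t ((u * t ^+ n) *: x - w); last by move/eqP: t_neq0.
by rewrite scalerBr -xw scalerA exprS mulrCA subrr.
Qed.

(** A relation between [x] and the generators [s] makes one of them
    superfluous as long as [x] is not divisible by [t]; when no relation is
    left, the coefficient of [x] is well defined. *)
Lemma split_off (s : seq V) (x : V) :
    (forall v, x <> t *: v) -> (forall v, gen_submod (x :: s) v) ->
  exists phi : V -> A, (forall a u v, phi (a *: u + v) = a * phi u + phi v) /\ phi x = 1.
Proof.
move=> xt; have [n] := ubnP (size s); elim: n s => // n IHn s /ltnSE szs sV.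
have [free|] := pselect (forall a, gen_submod s (a *: x) -> a = 0); last first.
  move=> /existsNP[a] /not_implyP[sax /eqP/(exchange_or_divisible sax)].
  move=> [[v /xt//]|[y ys gy]]; apply: (IHn (rem y s)).
    by rewrite size_rem //; case: s ys szs {sV sax gy}.
  move=> v; apply: gen_submod_trans (sV v) => z; rewrite inE.
  rewrite (perm_mem (perm_to_rem ys)) inE => /or3P[/eqP->|/eqP->//|zs].
    exact/gen_submod_mem/mem_head.
  by apply: gen_submod_mem; rewrite inE zs orbT.
have /choice[phi phiP] v : exists a, gen_submod s (v - a *: x).
  by have /gen_submod_cons[a [w sw ->]] := sV v; exists a; rewrite addrC addKr.
have phi_uniq v a : gen_submod s (v - a *: x) -> phi v = a.
  move=> sv; apply/eqP; rewrite -subr_eq0; apply/eqP/free.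
  suff -> : (phi v - a) *: x = (-1) *: (v - phi v *: x) + (v - a *: x).
    exact: gen_submod_lin.
  by rewrite scaleN1r scalerBl opprB addrA subrK.
exists phi; split=> [a u v|]; last by apply: phi_uniq; rewrite scale1r subrr; apply: gen_submod0.
apply: phi_uniq; have := gen_submod_lin a (phiP u) (phiP v).
by rewrite scalerBr scalerA addrACA -opprD -scalerDl.
Qed.

End TorsionFree.

(** * Frobenius push-forwards *)

Section FrobPushGen.
Variables (p : nat) (A : comNzRingType) (chA : p \in [pchar A]).

Let pX e (x y : A) : (x + y) ^+ (p ^ e) = x ^+ (p ^ e) + y ^+ (p ^ e).
Proof. by rewrite exprDn_pchar // pnatX (pnatE _ (pcharf_prime chA)) chA. Qed.

(** Products of [p]-th powers of generators for [e] with generators for [1]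
    generate for [e + 1]. *)
Lemma F_finite_iter e : F_finite chA -> fin_gen (frob_push chA e).
Proof.
have scaleE k (a x : A) :
    (a *: (x : frob_push chA k)) = (a ^+ (p ^ k) * x : A) by exact: frob_push_scaleE.
move=> [s sT]; elim: e => [|e [s' s'T]].
  exists [:: (1 : A)]; rewrite -subTset => x _; apply/gen_submod_cons.
  exists x, 0; first exact: gen_submod0.
  by rewrite addr0 scaleE expn0 expr1 mulr1.
pose S : seq A := [seq (c : A) ^+ p * (y : A) | c <- s', y <- s].
exists S; rewrite -subTset => z _; rewrite -[z](mul1r (z : A)) -(expr1n _ p); move: (1 : A).
have : gen_submod s z by rewrite sT.
apply: (gen_submod_min
  (W := [set z : frob_push chA 1 | forall c : A,
           @gen_submod A (frob_push chA e.+1) S (c ^+ p * z : A)])).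
- by move=> c; rewrite mulr0; apply: gen_submod0.
- move=> a u v Su Sv c; rewrite scaleE expn1 mulrDr mulrA -exprMn.
  exact: gen_submodD.
move=> y ys c; have : gen_submod s' c by rewrite s'T.
apply: (gen_submod_min
  (W := [set c : frob_push chA e |
           @gen_submod A (frob_push chA e.+1) S ((c : A) ^+ p * y : A)])).
- by rewrite /= expr0n -leqn0 leqNgt prime_gt0 ?mul0r ?(pcharf_prime chA)//; apply: gen_submod0.
- move=> a u v Su Sv; rewrite /= scaleE.
  rewrite -[X in _ ^+ X](expn1 p) pX expn1 mulrDl exprMn -exprM -expnSr -mulrA -scaleE.
  exact: gen_submod_lin.
by move=> x xs; apply: gen_submod_mem; apply/allpairsP; exists (x, y).
Qed.

End FrobPushGen.

(** * Thresholds in dimension one *)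

(** When [n * a < p ^ e] the element [(u * t ^+ n) ^+ a] is not divisible by
    [t ^+ (p ^ e)], the action of [t] on [F^e_* A], and so it splits off. *)
Lemma uniformizer_splitting (p e n a : nat) (A : comNzRingType) (chA : p \in [pchar A])
    (t u v : A) : F_finite chA -> ~ gen_ideal [:: t] 1 ->
    (forall a b : A, a * b = 0 -> a = 0 \/ b = 0) ->
    (forall f : A, f != 0 -> exists n u v, v * u = 1 /\ f = u * t ^+ n) ->
    t != 0 -> v * u = 1 -> (n * a < p ^ e)%N ->
  exists psi : A -> A, frob_linear p e psi /\ psi ((u * t ^+ n) ^+ a) = 1.
Proof.
move=> FA t1 domA valA t0 vu na.
have scaleE (b x : A) :
    (b *: (x : frob_push chA e)) = (b ^+ (p ^ e) * x : A) by exact: frob_push_scaleE.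
have powX0 m (x : A) : x ^+ m = 0 -> x = 0.
  elim: m => [/eqP|m IHm]; first by rewrite expr0 oner_eq0.
  by rewrite exprS => /domA[|/IHm].
have [s sT] := F_finite_iter e FA.
have [b x|w|w|phi [phi_lin phi1]] := @split_off A t (frob_push chA e) valA t0 _ s
    ((u * t ^+ n) ^+ a).
- by rewrite scaleE => /domA[/powX0|]; auto.
- rewrite scaleE; move: (w : A) => {}w; rewrite exprMn -exprM => tw.
  have : t ^+ (n * a) = t ^+ (p ^ e) * (v ^+ a * w).
    by rewrite mulrCA -tw mulrA -exprMn vu expr1n mul1r.
  rewrite -(subnKC (ltnW na)) exprD -mulrA.
  move=> /eqP; rewrite -subr_eq0 -{1}[t ^+ _]mulr1 -mulrBr => /eqP/domA[].
    by move=> /powX0 t00; move: t0; rewrite t00 eqxx.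
  move=> /eqP; rewrite subr_eq0 => /eqP tE; apply: t1; apply/gen_ideal1P.
  exists (t ^+ (p ^ e - n * a).-1 * (v ^+ a * w)).
  by rewrite tE mulrAC -exprSr prednK // subn_gt0.
- by apply/gen_submod_cons; exists 0, w; rewrite ?scale0r ?add0r // sT.
exists phi; split=> // z x y; rewrite -phi_lin; congr phi.
by rewrite scaleE.
Qed.

(** The exponents at which [u * t ^+ n] splits are those with
    [n * a < p ^ e], so the threshold is [1 / n]. *)
Theorem fpt_set1 (R : realType) (p : nat) (hp : prime p) (c : R) :
  fpt_set R 1 p c -> c = 0 \/ exists2 n, (0 < n)%N & c = n%:R^-1.
Proof.
move=> [A [chA [f [FA /regular_local1_dvr[t [t1 domA valA]] fT ->]]]].
have [->|f0] := eqVneq f 0; first by left; rewrite /fpt eqxx.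
right; have [n [u [v [vu fE]]]] := valA f f0.
have n0 : (0 < n)%N.
  rewrite lt0n; apply/eqP => n0; move/eqP: fT; apply; apply/gen_ideal_unit.
  by exists v; rewrite fE n0 expr0 mulr1.
have p1 := prime_gt1 hp; have nR : 0 < n%:R :> R by rewrite ltr0n.
have ub : ubound (split_exponents R p f) n%:R^-1.
  apply: (@split_exponents_le R p p1 A [:: t] f _ 0) => // E N _ EN.
  apply/gen_ideal1P; rewrite fE exprMn -exprM.
  have EnN : (p ^ E <= n * N)%N by rewrite -(ler_nat R) natrM -ler_pdivrMl.
  by exists (u ^+ N * t ^+ (n * N - p ^ E)); rewrite -mulrA -exprD subnK.
have t0 : t != 0 by apply: contra_neq f0 => t0; rewrite fE t0 expr0n -leqn0 leqNgt n0 mulr0.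
have mem e : (0 < e)%N ->
    split_exponents R p f (((p ^ e).-1 %/ n)%N%:R / ((p ^ e)%:R - 1)).
  move=> e0; have [|psi [psi_lin psi1]] :=
      @uniformizer_splitting p e n ((p ^ e).-1 %/ n) A chA t u v FA t1 domA valA t0 vu.
    rewrite mulnC (leq_ltn_trans (leq_trunc_div _ _)) // prednK // expn_gt0; lia.
  by apply: (split_exponents_mem _ p1 e0 psi_lin); rewrite fE.
exists n => //; rewrite (fptE R chA f0); apply/eqP; rewrite eq_le; apply/andP; split.
  by apply: ge_sup => //; eexists; exact: (mem 1%N).
rewrite leNgt; apply/negP; set S := sup _ => Sn.
have Sn' : 0 < 1 - n%:R * S by rewrite subr_gt0 mulrC -ltr_pdivlMr // div1r.
pose e := (Num.bound (n%:R / (1 - n%:R * S))).+1.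
have := ub_le_sup (ex_intro _ _ ub) (mem e isT).
rewrite leNgt => /negP; apply.
have e_lt : (e < p ^ e)%N by apply: ltn_expl.
have q0 : 0 < (p ^ e)%:R - 1 :> R by rewrite subr_gt0 ltr1n; lia.
rewrite ltr_pdivlMr //.
have eE : n%:R < (1 - n%:R * S) * e%:R.
  rewrite mulrC -ltr_pdivrMr //.
  apply: le_lt_trans (_ : _ <= (Num.bound (n%:R / (1 - n%:R * S)))%:R) _.
    by rewrite ltW // archi_boundP // divr_ge0 ?ltW.
  by rewrite ltr_nat.
have q_ge : (p ^ e <= n * ((p ^ e).-1 %/ n) + n)%N.
  have := divn_eq (p ^ e).-1 n; have := ltn_pmod (p ^ e).-1 n0; lia.
have q_ge_e : e%:R <= (p ^ e)%:R - 1 :> R.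
  by rewrite lerBrDr natr1 ler_nat.
move: q_ge; rewrite -(ler_nat R) natrD natrM.
set a := (_ %/ n)%:R; set q := (p ^ e)%:R in q0 q_ge_e * => q_ge.
have prod := ler_wpM2l (ltW Sn') q_ge_e.
rewrite -(ltr_pM2l nR) -/S; lra.
Qed.

(** * Localization of a domain at the kernel of a point *)

Section Localization.
Variables (R : idomainType) (F : fieldType) (ev : {rmorphism R -> F}).
Local Notation "a %:F" := (FracField.tofrac a).

Definition loc_pred : {pred {fraction R}} :=
  fun z => `[< exists a b, ev b != 0 /\ z = a%:F / b%:F >].

Lemma loc_predP z : reflect (exists a b, ev b != 0 /\ z = a%:F / b%:F) (z \in loc_pred).
Proof. exact: asboolP. Qed.

Let ev_neq0 b : ev b != 0 -> b%:F != 0.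
Proof. by apply: contra_neq => /eqP; rewrite tofrac_eq0 => /eqP->; rewrite rmorph0. Qed.

Fact loc_subring : subring_closed loc_pred.
Proof.
split.
- by apply/loc_predP; exists 1, 1; rewrite rmorph1 oner_eq0 divr1.
- move=> _ _ /loc_predP[a [b [b0 ->]]] /loc_predP[c [d [d0 ->]]]; apply/loc_predP.
  exists (a * d - c * b), (b * d); rewrite rmorphM mulf_neq0 //; split=> //.
  rewrite -[- (c%:F / _)]mulNr addf_div ?ev_neq0 // tofracB !tofracM.
  by rewrite mulNr.
- move=> _ _ /loc_predP[a [b [b0 ->]]] /loc_predP[c [d [d0 ->]]]; apply/loc_predP.
  exists (a * c), (b * d); rewrite rmorphM mulf_neq0 //; split=> //.
  by rewrite mulf_div !tofracM.
Qed.

HB.instance Definition _ := GRing.isSubringClosed.Build {fraction R} loc_pred loc_subring.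

Record loc := Loc { loc_val : {fraction R}; _ : loc_val \in loc_pred }.

HB.instance Definition _ := [isSub for loc_val].
HB.instance Definition _ := [Choice of loc by <:].
HB.instance Definition _ := [SubChoice_isSubComNzRing of loc by <:].

Fact toloc_subproof a : a%:F \in loc_pred.
Proof. by apply/loc_predP; exists a, 1; rewrite rmorph1 oner_eq0 divr1. Qed.

Definition toloc a : loc := Loc (toloc_subproof a).

Fact toloc_zmod : zmod_morphism toloc.
Proof. by move=> a b; apply: val_inj; rewrite /= tofracB. Qed.

Fact toloc_monoid : monoid_morphism toloc.
Proof. by split=> [|a b]; apply: val_inj; rewrite /= ?tofracM. Qed.

HB.instance Definition _ := GRing.isZmodMorphism.Build R loc toloc toloc_zmod.
HB.instance Definition _ := GRing.isMonoidMorphism.Build R loc toloc toloc_monoid.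

Lemma toloc0 : toloc 0 = 0. Proof. exact: rmorph0. Qed.
Lemma toloc1 : toloc 1 = 1. Proof. exact: rmorph1. Qed.
Lemma tolocD : {morph toloc : a b / a + b}. Proof. exact: rmorphD. Qed.
Lemma tolocM : {morph toloc : a b / a * b}. Proof. exact: rmorphM. Qed.
Lemma tolocXn n : {morph toloc : a / a ^+ n}. Proof. exact: rmorphXn. Qed.

Lemma toloc_inj : injective toloc.
Proof. by move=> a b /(congr1 val)/= /eqP; rewrite tofrac_eq => /eqP. Qed.

Lemma loc_frac z : exists a b, ev b != 0 /\ z * toloc b = toloc a.
Proof.
have /loc_predP[a [b [b0 zE]]] := valP z; exists a, b; split=> //.
by apply: val_inj; rewrite /= zE divfK // ev_neq0.
Qed.

Lemma toloc_unit b : ev b != 0 -> exists y, toloc b * y = 1.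
Proof.
move=> b0; have bP : (b%:F)^-1 \in loc_pred.
  by apply/loc_predP; exists 1, b; rewrite tofrac1 mul1r.
by exists (Loc bP); apply: val_inj; rewrite /= divff // ev_neq0.
Qed.

Lemma toloc_cancel b u v : ev b != 0 -> u * toloc b = v * toloc b -> u = v.
Proof.
move=> /toloc_unit[y by1] /(congr1 ( *%R^~ y)).
by rewrite -!mulrA by1 !mulr1.
Qed.

End Localization.

Section LocTheory.
Variables (R : idomainType) (F : fieldType) (ev : {rmorphism R -> F}).
Local Notation A := (loc ev).
Local Notation toloc := (toloc ev).

Lemma ev_neq0_pow b n : ev b != 0 -> ev (b ^+ n) != 0.
Proof. by move=> b0; rewrite rmorphXn expf_neq0. Qed.

Lemma loc_noetherian : ideals_fin_gen R -> noetherian A.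
Proof.
move=> fgR; apply: ideals_fin_gen_noetherian => I I_ideal.
have [|s sE] := fgR [set a | I (toloc a)].
  split=> [|a u v Iu Iv] /=; first by rewrite toloc0; case: I_ideal.
  by rewrite tolocD tolocM; apply: I_ideal.2.
exists (map toloc s); apply/seteqP; split=> z; last first.
  apply: gen_ideal_min => // _ /mapP[a as_ ->].
  by have : gen_ideal s a := gen_ideal_mem as_; rewrite -sE.
move=> Iz; have [a [b [b0 za]]] := loc_frac z; have [y by1] := toloc_unit b0.
have sP := gen_ideal_is_ideal (map toloc s).
have -> : z = y * toloc a by rewrite -za mulrCA [y * _]mulrC by1 mulr1.
apply: is_idealM => //; have : [set a | I (toloc a)] a.
  by rewrite /= -za mulrC; apply: is_idealM.
rewrite sE; apply: (gen_ideal_min (I := [set a | gen_ideal (map toloc s) (toloc a)])).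
  split=> [|c u v su sv] /=; first by rewrite toloc0; case: sP.
  by rewrite tolocD tolocM; apply: sP.2.
by move=> v vs; apply/gen_ideal_mem/map_f.
Qed.

Section KernelPrime.
Variables (D : idomainType) (g : {rmorphism R -> D}).
Hypothesis g_ev : forall a, g a = 0 -> ev a = 0.

(** The extension to the localization of the prime ideal that is the kernel
    of [g]. *)
Definition loc_ker : set A :=
  [set z | exists a b, [/\ ev b != 0, g a = 0 & z * toloc b = toloc a]].

Let g_neq0 b : ev b != 0 -> g b != 0.
Proof. by apply: contra_neq => /g_ev. Qed.

Lemma loc_kerE (z : A) a b : ev b != 0 -> z * toloc b = toloc a -> loc_ker z <-> g a = 0.
Proof.
move=> b0 za; split=> [[c [d [d0 gc zc]]]|ga]; last by exists a, b.
have : a * d = c * b.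
  by apply: (@toloc_inj _ _ ev); rewrite !tolocM -za -zc mulrAC.
move/(congr1 g)/eqP; rewrite !rmorphM gc mul0r mulf_eq0.
by rewrite (negPf (g_neq0 d0)) orbF => /eqP.
Qed.

Lemma loc_ker_toloc a : loc_ker (toloc a) <-> g a = 0.
Proof. by apply: (@loc_kerE _ _ 1); rewrite ?rmorph1 ?oner_eq0 ?toloc1 ?mulr1. Qed.

Lemma loc_ker_prime : prime_ideal ([in loc_ker] : {pred A}).
Proof.
split; first apply/idealr_closedP; rewrite ?set_in.
  split; last by rewrite -(toloc1 ev) => /loc_ker_toloc; rewrite rmorph1 => /eqP; rewrite oner_eq0.
  split=> [|z u v]; first by rewrite -(toloc0 ev); apply/loc_ker_toloc; rewrite rmorph0.
  move=> [a [b [b0 ga ua]]] [c [d [d0 gc vc]]].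
  have [x [y [y0 zx]]] := loc_frac z.
  exists (x * a * d + c * b * y), (b * d * y); split.
  - by rewrite !rmorphM !mulf_neq0.
  - by rewrite rmorphD !rmorphM ga gc mulr0 !mul0r add0r.
  - by rewrite tolocD !tolocM -ua -vc -zx; ring.
move=> u v /set_mem uv; have [a [b [b0 ua]]] := loc_frac u.
have [c [d [d0 vc]]] := loc_frac v.
have bd0 : ev (b * d) != 0 by rewrite rmorphM mulf_neq0.
have uvE : u * v * toloc (b * d) = toloc (a * c) by rewrite !tolocM mulrACA ua vc.
move/eqP: (iffLR (loc_kerE bd0 uvE) uv); rewrite rmorphM mulf_eq0 => /orP[]/eqP g0.
  by apply/orP; left; apply/mem_set/(loc_kerE b0 ua).
by apply/orP; right; apply/mem_set/(loc_kerE d0 vc).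
Qed.

End KernelPrime.

Definition loc_max : {pred A} := [in loc_ker ev].

Lemma loc_max_toloc a : toloc a \in loc_max <-> ev a = 0.
Proof.
split=> [/set_mem/(loc_ker_toloc (g := ev))|a0]; first exact.
by apply/mem_set/loc_ker_toloc.
Qed.

Lemma ideal_sub_loc_max (N : {pred A}) : idealr_closed N -> {subset N <= loc_max}.
Proof.
move=> /idealr_closedP[N_ideal N1] z zN; have [a [b [b0 za]]] := loc_frac z.
apply/mem_set/(loc_kerE (g := ev) (fun _ => id) b0 za)/eqP; apply: contrapT => /negP a0.
apply: N1; have [y <-] := toloc_unit a0; rewrite -za -mulrA mulrC.
exact: is_idealM.
Qed.

Lemma loc_max_maximal : maximal_ideal loc_max.
Proof.
split; first by case: (loc_ker_prime (g := ev)).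
by move=> N NP MN z; apply/idP/idP => [/(ideal_sub_loc_max NP)|/MN].
Qed.

Lemma loc_max_unique (N : {pred A}) : maximal_ideal N -> N =i loc_max.
Proof.
move=> [NP Nmax] z; rewrite (Nmax loc_max) //; first by case: loc_max_maximal.
exact: ideal_sub_loc_max.
Qed.

(** Clearing denominators by [p ^ e]-th powers extends [psi] from [R] to its
    localization. *)
Lemma frob_linear_loc p e (psi : R -> R) : (0 < p)%N -> frob_linear p e psi ->
  exists2 Psi : A -> A, frob_linear p e Psi & forall a, Psi (toloc a) = toloc (psi a).
Proof.
move=> p0 psi_lin; set q := (p ^ e)%N; have q0 : (0 < q)%N by rewrite expn_gt0 p0.
have fracX z : exists a b, ev b != 0 /\ z * toloc (b ^+ q) = toloc a.
  have [a [b [b0 za]]] := loc_frac z; exists (a * b ^+ q.-1), b; split=> //.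
  by rewrite -(prednK q0) exprS !tolocM mulrA za prednK.
pose rel z y := forall a b, ev b != 0 -> z * toloc (b ^+ q) = toloc a ->
  y * toloc b = toloc (psi a).
have relE z y a b : ev b != 0 -> z * toloc (b ^+ q) = toloc a ->
    y * toloc b = toloc (psi a) -> rel z y.
  move=> b0 za ya c d d0 zc; apply: (toloc_cancel b0); rewrite mulrAC ya -!tolocM.
  congr toloc; rewrite mulrC [_ * b]mulrC -!(frob_linearM psi_lin); congr psi.
  apply: (@toloc_inj _ _ ev); rewrite 2!tolocM -za -zc mulrCA.
  by rewrite [toloc (b ^+ q) * _]mulrCA [toloc (b ^+ q) * _]mulrC.
have /choice[Psi PsiP] z : exists y, rel z y.
  have [a [b [b0 za]]] := fracX z; have [w bw] := toloc_unit b0.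
  exists (w * toloc (psi a)); apply: (relE _ _ _ _ b0 za).
  by rewrite mulrAC [w * _]mulrC bw mul1r.
have rel_uniq z y : rel z y -> Psi z = y.
  move=> zy; have [a [b [b0 za]]] := fracX z.
  by apply: (toloc_cancel b0); rewrite (PsiP _ _ _ b0 za) (zy _ _ b0 za).
exists Psi => [z u v|a]; last first.
  apply: rel_uniq; apply: (relE _ _ a 1); rewrite ?rmorph1 ?oner_eq0 //.
    by rewrite expr1n toloc1 mulr1.
  by rewrite mulr1.
apply: rel_uniq.
have [a0 [b0 [b0P za]]] := loc_frac z.
have [c0 [b1 [b1P uc]]] := fracX u; have [d0 [b2 [b2P vd]]] := fracX v.
pose b := b0 * b1 * b2; have bP : ev b != 0 by rewrite !rmorphM !mulf_neq0.
pose a := a0 * b1 * b2; pose c := c0 * (b0 * b2) ^+ q; pose d := d0 * (b0 * b1) ^+ q.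
have zb : z * toloc b = toloc a by rewrite /b /a !tolocM -za; ring.
have ub : u * toloc (b ^+ q) = toloc c.
  by rewrite /c tolocM -uc -mulrA -tolocM -exprMn /b; congr (_ * toloc (_ ^+ _)); ring.
have vb : v * toloc (b ^+ q) = toloc d.
  by rewrite /d tolocM -vd -mulrA -tolocM -exprMn /b; congr (_ * toloc (_ ^+ _)); ring.
clearbody a c d b.
apply: (relE _ _ (a ^+ q * c + b ^+ q * d) (b ^+ 2)); first exact: ev_neq0_pow.
  have aqE : toloc (a ^+ q) = z ^+ q * toloc (b ^+ q) by rewrite !tolocXn -zb exprMn.
  have bqE : toloc (b ^+ 2 ^+ q) = toloc (b ^+ q) * toloc (b ^+ q).
    by rewrite -tolocM -expr2 exprAC.
  by rewrite tolocD !tolocM -ub -vb aqE bqE -/q; ring.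
rewrite psi_lin (frob_linearM psi_lin) tolocD !tolocM -(PsiP _ _ _ bP ub).
by rewrite -(PsiP _ _ _ bP vb) -zb; ring.
Qed.

End LocTheory.

Arguments loc_ker {R F} ev {D} g _.
Arguments loc_max {R F} ev _.

(** * Passing to polynomials and to the localization *)

(** F-finiteness as an induction principle: what is closed under sums and
    under multiplication by [p]-th powers need only be checked on [s]. *)
Lemma F_finiteP (p : nat) (A : comNzRingType) (chA : p \in [pchar A]) :
  F_finite chA <-> exists s : seq A, forall W : set A,
    W 0 -> (forall a u v, W u -> W v -> W (a ^+ p * u + v)) ->
    (forall v, v \in s -> W v) -> forall z, W z.
Proof.
have scaleE (a x : A) : (a *: (x : frob_push chA 1)) = (a ^+ p * x : A).
  exact: frob_push_scaleE.
split=> -[s sP]; exists s.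
  move=> W W0 Wlin sW z; have : @gen_submod A (frob_push chA 1) s z by rewrite sP.
  by apply: gen_submod_min => // a u v Wu Wv; rewrite scaleE; apply: Wlin.
rewrite -subTset => z _; move: z; apply: sP.
- exact: gen_submod0.
- move=> a u v su sv; rewrite -scaleE; exact: gen_submod_lin.
- exact: (@gen_submod_mem A (frob_push chA 1)).
Qed.

Lemma F_finite_poly (p : nat) (S : comNzRingType) (chS : p \in [pchar S])
  (chP : p \in [pchar {poly S}]) : F_finite chS -> F_finite chP.
Proof.
move=> /F_finiteP[s sP]; apply/F_finiteP.
have p0 : (0 < p)%N := prime_gt0 (pcharf_prime chS).
exists [seq c%:P * 'X^i | c <- s, i <- iota 0 p] => W W0 Wlin sW.
have WD f g : W f -> W g -> W (f + g).
  by move=> Wf Wg; have := Wlin 1 f g Wf Wg; rewrite expr1n mul1r.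
suff mono c n : W (c%:P * 'X^n).
  move=> f; rewrite -[f]coefK poly_def; elim/big_ind: _ => // i _.
  by rewrite -mul_polyC.
move: c n; apply: sP => [n|a u v Wu Wv n|y ys n]; first by rewrite mul0r.
  by rewrite polyCD polyCM mulrDl -mulrA polyC_exp; apply: Wlin.
rewrite (divn_eq n p) exprD exprM mulrCA -[_ * _]addr0; apply: Wlin => //.
by apply: sW; apply/allpairsP; exists (y, n %% p)%N; rewrite mem_iota /= add0n ltn_pmod.
Qed.

(** A fraction [a / b] equals [(1 / b) ^ p * (a * b ^ (p - 1))]. *)
Lemma F_finite_loc (p : nat) (R : idomainType) (F : fieldType) (ev : {rmorphism R -> F})
    (chR : p \in [pchar R]) (chA : p \in [pchar (loc ev)]) :
  F_finite chR -> F_finite chA.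
Proof.
move=> /F_finiteP[s sP]; apply/F_finiteP.
have p0 : (0 < p)%N := prime_gt0 (pcharf_prime chR).
exists (map (toloc ev) s) => W W0 Wlin sW.
have WD u v : W u -> W v -> W (u + v).
  by move=> Wu Wv; have := Wlin 1 u v Wu Wv; rewrite expr1n mul1r.
suff all a (y : loc ev) : W (y ^+ p * toloc ev a).
  move=> z; have [a [b [b0 za]]] := loc_frac z; have [y by1] := toloc_unit b0.
  suff -> : z = y ^+ p * toloc ev (a * b ^+ p.-1) by [].
  have bp1 : toloc ev b ^+ p * y ^+ p = 1 by rewrite -exprMn by1 expr1n.
  rewrite tolocM -za -mulrA -tolocM -exprS prednK // tolocXn.
  by rewrite mulrCA [y ^+ p * _]mulrC bp1 mulr1.
move: a y; apply: sP => [y|a u v Wu Wv y|x xs y]; first by rewrite toloc0 mulr0.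
  by rewrite tolocD tolocM tolocXn mulrDr mulrA -exprMn; apply: WD.
by rewrite -[_ * _]addr0; apply: Wlin => //; apply/sW/map_f.
Qed.

(** The [u]-th component of the decomposition of [S[X]] over its subring of
    [p ^ e]-th powers, composed with a splitting on the coefficients. *)
Lemma frob_linear_poly (p e u : nat) (S : comNzRingType) (psi : S -> S) :
    p \in [pchar S] -> frob_linear p e psi -> (u < p ^ e)%N ->
  exists2 Psi : {poly S} -> {poly S}, frob_linear p e Psi &
    forall a, (Psi a)`_0 = psi a`_u.
Proof.
move=> chS psi_lin; set q := (p ^ e)%N => uq.
have chP : p \in [pchar {poly S}] := rmorph_pchar (@polyC S) chS.
pose Psi (a : {poly S}) := \poly_(i < size a) psi a`_(i * q + u).
have q0 : (0 < q)%N by apply: leq_ltn_trans uq.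
have coefPsi a i : (Psi a)`_i = psi a`_(i * q + u).
  rewrite coef_poly; case: ltnP => // ai; rewrite nth_default ?(frob_linear0 psi_lin) //.
  by rewrite (leq_trans ai) // (leq_trans (leq_pmulr i q0)) // leq_addr.
have PsiD a b : Psi (a + b) = Psi a + Psi b.
  by apply/polyP => i; rewrite coefD !coefPsi coefD (frob_linearD psi_lin).
have PsiX a : Psi ('X^q * a) = 'X * Psi a.
  apply/polyP => -[|i]; rewrite coefPsi coefXM coefXnM.
    by rewrite mul0n add0n uq (frob_linear0 psi_lin).
  by rewrite ltnNge mulSn -addnA leq_addr /= coefPsi addKn.
have PsiC c a : Psi ((c ^+ q)%:P * a) = c%:P * Psi a.
  by apply/polyP => i; rewrite coefCM !coefPsi coefCM (frob_linearM psi_lin).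
have powD (z w : {poly S}) : (z + w) ^+ q = z ^+ q + w ^+ q.
  by rewrite exprDn_pchar // pnatX (pnatE _ (pcharf_prime chP)) chP.
exists Psi => [z a b|a]; last by rewrite coefPsi.
rewrite PsiD; congr (_ + _); elim/poly_ind: z => [|z c IHz].
  rewrite expr0n -leqn0 leqNgt q0 !mul0r.
  by apply/polyP => i; rewrite coefPsi !coef0 (frob_linear0 psi_lin).
rewrite powD -polyC_exp !mulrDl PsiD PsiC exprMn mulrAC mulrC PsiX IHz.
by rewrite mulrC mulrAC.
Qed.

(** * The local ring of the plane at the origin *)

Section Plane.
Variables (p : nat) (hp : prime p).
Local Notation K := 'F_p.
Local Notation R2 := {poly {poly K}}.

(** The outer variable of [R2] is the coordinate [x], the inner one is [y]. *)
Definition origin : {rmorphism R2 -> K} :=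
  horner_eval (0 : K) \o horner_eval (0 : {poly K}).

Lemma originE (a : R2) : origin a = a`_0`_0.
Proof. by rewrite /= /horner_eval !horner_coef0. Qed.

Local Notation A := (loc origin).

Lemma pchar_plane : p \in [pchar A].
Proof.
apply: (rmorph_pchar (toloc origin)); apply: (rmorph_pchar (@polyC _)).
apply: (rmorph_pchar (@polyC _)); exact: pchar_Fp.
Qed.

Lemma Fp_pow (c : K) e : c ^+ (p ^ e) = c.
Proof.
elim: e => [|e IHe]; first by rewrite expn0 expr1.
by rewrite expnSr exprM IHe; have := expf_card c; rewrite card_Fp.
Qed.

Lemma plane_F_finite : F_finite pchar_plane.
Proof.
have chK : p \in [pchar K] := pchar_Fp hp.
have chK1 : p \in [pchar {poly K}] := rmorph_pchar (@polyC _) chK.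
have chK2 : p \in [pchar R2] := rmorph_pchar (@polyC _) chK1.
apply/(F_finite_loc (chR := chK2))/(F_finite_poly (chS := chK1)).
apply/(F_finite_poly (chS := chK))/F_finiteP; exists [:: 1] => W W0 Wlin W1 c.
have := Wlin c 1 0 (W1 _ (mem_head _ _)) W0.
by rewrite addr0 mulr1; have := Fp_pow c 1; rewrite expn1 => ->.
Qed.

Lemma plane_noetherian : noetherian A.
Proof.
apply: loc_noetherian => I; apply: Hilbert_basis; apply: ideals_fin_gen_noetherian => J.
apply: Hilbert_basis; move=> P /idealr_closedP[P_ideal P1].
exists [::]; apply/seteqP; split=> [c Pc|c /(@gen_submod_nil K K^o)->]; last by case: P_ideal.
apply/(@gen_submod_nil K K^o)/eqP; apply: contrapT => /negP c0; apply: P1.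
by rewrite -(mulVf c0); apply: is_idealM.
Qed.

(** Projection onto the component of the monomial [x ^ u * y ^ v] in the basis
    of [F^e_* A] sends [a] to an element that does not vanish at the origin. *)
Lemma plane_splitting e u v (a : R2) : (u < p ^ e)%N -> (v < p ^ e)%N -> a`_u`_v != 0 ->
  exists2 psi : A -> A, frob_linear p e psi & psi (toloc origin a) = 1.
Proof.
move=> ue ve auv; have chK : p \in [pchar K] := pchar_Fp hp.
have chK1 : p \in [pchar {poly K}] := rmorph_pchar (@polyC _) chK.
have idK : frob_linear p e (@id K) by move=> z x y; rewrite Fp_pow.
have [psi1 psi1_lin psi1E] := frob_linear_poly chK idK ve.
have [psi2 psi2_lin psi2E] := frob_linear_poly chK1 psi1_lin ue.
have [psi psi_lin psiE] := frob_linear_loc origin (prime_gt0 hp) psi2_lin.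
have [|w w1] := @toloc_unit _ _ origin (psi2 a); first by rewrite originE psi2E psi1E.
exists (fun x => w * psi x); last by rewrite psiE mulrC.
by move=> z x y; rewrite psi_lin; ring.
Qed.
End Plane.

(** * Dimension of the plane at the origin *)

Lemma poly_const_split (S : nzRingType) (a : {poly S}) : exists b, a = b * 'X + (a`_0)%:P.
Proof.
elim/poly_ind: a => [|a c _]; first by exists 0; rewrite mul0r add0r coef0.
by exists a; rewrite coefD coefMX coefC add0r.
Qed.

Section PlanePrimes.
Variables (K : fieldType).
Local Notation R2 := {poly {poly K}}.
Local Notation x := ('X : R2).
Local Notation y := (('X : {poly K})%:P : R2).

(** The prime ideals of [K[x, y]] that survive in the local ring of the
    origin. *)
Definition prime_at_origin (Q : set R2) : Prop :=
  [/\ is_ideal Q, forall a b, Q (a * b) -> Q a \/ Q b &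
      forall a, Q a -> a`_0`_0 = 0].

Lemma prime_pow Q a n : prime_at_origin Q -> Q (a ^+ n) -> Q a.
Proof.
move=> [_ Qprime Q0]; elim: n => [|n IHn]; last by rewrite exprS => /Qprime[//|/IHn].
by rewrite expr0 => /Q0; rewrite !coef1 /= => /eqP; rewrite oner_eq0.
Qed.

Lemma poly_order (c : {poly K}) : c != 0 ->
  exists n (d : {poly K}), d`_0 != 0 /\ c = d * 'X^n.
Proof.
move=> c0; have [n [d]] := multiplicity_XsubC c 0; rewrite c0 /= => d0 ->.
by exists n, d; rewrite subr0 -horner_coef0.
Qed.

Lemma prime_const Q c : prime_at_origin Q -> Q c%:P -> c != 0 -> Q y.
Proof.
move=> Qp Qc /poly_order[n [d [d0 cE]]]; move: Qc; have [_ Qprime Q0] := Qp.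
rewrite cE polyCM => /Qprime[/Q0|]; first by rewrite coefC /= => /eqP; rewrite (negPf d0).
by rewrite polyC_exp => /(prime_pow Qp).
Qed.

(** Over the fraction field of [K[y]] the polynomial ring in [x] is principal,
    so there is no room between two nonzero primes: the larger one must meet
    [K[y]], and hence contain [y]. *)
Lemma prime_y P Q : prime_at_origin P -> prime_at_origin Q -> P `<=` Q ->
  (exists2 a, P a & a != 0) -> ~ Q `<=` P -> Q y.
Proof.
move=> Pp Qp PQ [a Pa a0] QP; apply: contrapT => Qy.
have const c : Q c%:P -> c = 0.
  by move=> Qc; apply/eqP; apply: contrapT => /negP/(prime_const Qp Qc).
have [[[P0 Plin] Pprime _] [[Q0 Qlin] _ _]] := (Pp, Qp).
have minimal (I : set R2) : (exists2 a, I a & a != 0) -> exists h, [/\ I h, h != 0 &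
    forall g, I g -> g != 0 -> (size h <= size g)%N].
  move=> [b Ib b0]; pose N n := `[< exists g, [/\ I g, g != 0 & size g = n] >].
  have exN : exists n, N n by exists (size b); apply/asboolP; exists b.
  case: (ex_minnP exN) => n /asboolP[h [Ih h0 hn]] nmin.
  exists h; split=> // g Ig g0; rewrite hn; apply: nmin; apply/asboolP.
  by exists g.
have [h [Ph h0 hmin]] := minimal P (ex_intro2 _ _ a Pa a0).
have [k [Qk k0 kmin]] := minimal Q (ex_intro2 _ _ a (PQ _ Pa) a0).
have lead0 n : lead_coef k ^+ n != 0 by rewrite expf_neq0 // lead_coef_eq0.
have divk f : Q f -> lead_coef k ^+ scalp f k *: f = f %/ k * k.
  move=> Qf; have fE := Pdiv.Idomain.divp_eq f k; rewrite fE.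
  suff -> : f %% k = 0 by rewrite addr0.
  apply/eqP; apply: contrapT => /negP r0; have := kmin (f %% k).
  rewrite leqNgt ltn_modp k0 => /(_ _ r0).
  have -> : f %% k = - (f %/ k) * k + (lead_coef k ^+ scalp f k)%:P * f.
    by rewrite mul_polyC fE mulNr addKr.
  by move=> /(_ (Qlin _ _ _ Qk (is_idealM _ (conj Q0 Qlin) Qf))).
have Pk : P k.
  have := divk h (PQ _ Ph); set c := lead_coef k ^+ _ => hE.
  have : P (h %/ k * k) by rewrite -hE -mul_polyC; apply: is_idealM.
  move=> /Pprime[Phk|//]; have hk0 : h %/ k != 0.
    apply: contra_neq h0 => hk; move/eqP: hE; rewrite hk mul0r -mul_polyC mulf_eq0.
    by rewrite polyC_eq0 (negPf (lead0 _)) => /eqP.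
  have := hmin _ Phk hk0; have := congr1 (fun f : R2 => size f) hE.
  rewrite size_scale ?lead0 // size_mul // => -> sz.
  have /size_poly1P[d d0 kd] : size k == 1%N.
    move: sz hk0 k0; rewrite -!size_poly_gt0.
    by move: (size k) (size (h %/ k)) => m n; lia.
  by move: Qk; rewrite kd => /const d00; move: d0; rewrite d00 eqxx.
apply: QP => f Qf; have : P ((lead_coef k ^+ scalp f k)%:P * f).
  by rewrite mul_polyC divk //; apply: is_idealM.
by move=> /Pprime[/PQ/const/eqP|//]; rewrite (negPf (lead0 _)).
Qed.

Lemma y_divides (a : R2) : (forall i, a`_i`_0 = 0) -> exists b, a = y * b.
Proof.
move=> a0; have /choice[b bE] i : exists b, a`_i = b * 'X.
  by have [b bE] := poly_const_split a`_i; exists b; rewrite {1}bE a0 polyC0 addr0.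
exists (\poly_(i < size a) b i); apply/polyP => i; rewrite coefCM coef_poly.
by case: ltnP => ai; [rewrite bE mulrC|rewrite nth_default ?mulr0].
Qed.

(** If the larger prime contained [y] but not [x] it would be generated by
    [y], and the elements of the smaller one could be divided by [y] without
    end. *)
Lemma prime_x P Q : prime_at_origin P -> prime_at_origin Q -> P `<=` Q ->
  (exists2 a, P a & a != 0) -> ~ Q `<=` P -> Q y -> Q x.
Proof.
move=> Pp Qp PQ [a Pa a0] QP Qy; apply: contrapT => Qx.
have [[_ Pprime _] [Qid Qprime Q0]] := (Pp, Qp).
have Qdiv b : Q b -> exists c, b = y * c.
  move=> Qb; apply: y_divides => i; pose b0 := map_poly (fun c : {poly K} => c`_0) b.
  have b0E j : b0`_j = b`_j`_0 by rewrite coef_map_id0 ?coef0.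
  suff b00 : b0 = 0 by rewrite -b0E b00 coef0.
  apply/eqP; apply: contrapT => /negP/poly_order[n [d [d0 dE]]].
  have [c cE] : exists c, b - map_poly polyC b0 = y * c.
    by apply: y_divides => j; rewrite !coefB coef_map /= b0E coefC subrr.
  have : Q (map_poly polyC b0).
    rewrite -(subKr b (map_poly _ _)) cE -mulrN mulrC addrC.
    exact: Qid.2.
  rewrite dE rmorphM /= map_polyXn => /Qprime[/Q0|/(prime_pow Qp)//].
  by rewrite coef_map coefC /= => /eqP; rewrite (negPf d0).
have Py : ~ P y by move=> Py; apply: QP => b /Qdiv[c ->]; rewrite mulrC; apply: is_idealM; case: Pp.
move/negP: a0; apply; apply/eqP.
have [n] := ubnP (size (lead_coef a)); elim: n a Pa => // n IHn a Pa /ltnSE sz.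
have [->//|a0] := eqVneq a 0; have [b aE] := Qdiv a (PQ _ Pa).
have /IHn b0 : P b by move: Pa; rewrite aE => /Pprime[].
rewrite aE b0 ?mulr0 //; move: sz; rewrite aE lead_coefM lead_coefC mulrC size_mulX //.
by rewrite lead_coef_eq0; apply: contra_neq a0 => bE; rewrite aE bE mulr0.
Qed.

End PlanePrimes.

Section PlaneRegular.
Variables (p : nat).
Local Notation K := 'F_p.
Local Notation R2 := {poly {poly K}}.
Local Notation A := (loc (origin p)).
Local Notation toloc := (toloc (origin p)).
Local Notation x := ('X : R2).
Local Notation y := (('X : {poly K})%:P : R2).

Lemma plane_max_gen : [set` loc_max (origin p)] = gen_ideal [:: toloc x; toloc y].
Proof.
have /idealr_closedP[M_ideal _] := (loc_max_maximal (origin p)).1.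
apply/seteqP; split=> z; last first.
  apply: gen_ideal_min => // v; rewrite !inE => /orP[]/eqP->; apply/loc_max_toloc; rewrite originE.
    by rewrite coefX coef0.
  by rewrite coefC coefX.
have [a [b [b0 za]]] := loc_frac z.
move=> /set_mem/(loc_kerE (g := origin p) (fun _ => id) b0 za); rewrite originE => a0.
have [w bw] := toloc_unit b0; have [c aE] := poly_const_split a.
have [d cE] := poly_const_split a`_0; rewrite a0 polyC0 addr0 in cE.
have -> : z = w * toloc a by rewrite -za mulrCA [w * _]mulrC bw mulr1.
apply/gen_ideal2P; exists (w * toloc c), (w * toloc d%:P).
by rewrite {1}aE cE polyCM tolocD !tolocM; ring.
Qed.

Definition contract (P : {pred A}) : set R2 := [set a | toloc a \in P].

Lemma contract_prime P : prime_ideal P -> prime_at_origin (contract P).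
Proof.
move=> [PP Pprime]; have /idealr_closedP[[P0 Plin] _] := PP; split.
- by split=> [|a u v]; rewrite /contract /= ?toloc0 // tolocD tolocM; apply: Plin.
- by move=> a b; rewrite /contract /= tolocM => /Pprime/orP.
- by move=> a /(ideal_sub_loc_max PP)/loc_max_toloc; rewrite originE.
Qed.

Lemma contract_sub P Q : idealr_closed P -> idealr_closed Q ->
  contract Q `<=` contract P -> [set` Q] `<=` [set` P].
Proof.
move=> /idealr_closedP[P_ideal _] /idealr_closedP[Q_ideal _] QP z Qz.
have [a [b [b0 za]]] := loc_frac z; have [w bw] := toloc_unit b0.
have -> : z = w * toloc a by rewrite -za mulrCA [w * _]mulrC bw mulr1.
apply: is_idealM => //; apply: QP; rewrite /contract /= -za mulrC.
exact: is_idealM Q_ideal Qz.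
Qed.

Lemma plane_krull_dim : krull_dim A 2.
Proof.
split.
  have id0 (a : R2) : idfun a = 0 -> origin p a = 0.
    by move=> a0; have -> : a = 0 by []; exact: rmorph0.
  have hor0 (a : R2) : horner_eval (0 : {poly K}) a = 0 -> origin p a = 0.
    by rewrite originE /horner_eval horner_coef0 => ->; rewrite coef0.
  exists (fun i => match i with
    | 0 => [in loc_ker (origin p) (idfun : {rmorphism R2 -> R2})]
    | 1 => [in loc_ker (origin p) (horner_eval (0 : {poly K}))]
    | _ => loc_max (origin p) end).
  split=> [[|[|i]] _|[|[|i]] // _]; first exact: loc_ker_prime id0.
  - exact: loc_ker_prime hor0.
  - exact: (loc_ker_prime (g := origin p)).
  - split=> [z /set_mem|].
      move=> [a [b [b0 a0 za]]]; apply/mem_set; exists a, b; split=> //.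
      by rewrite (a0 : a = 0) rmorph0.
    move=> /(_ (toloc x))/= H.
    have /H/set_mem/(loc_ker_toloc id0)/= :
        toloc x \in [in loc_ker (origin p) (horner_eval (0 : {poly K}))].
      apply/mem_set/(loc_ker_toloc hor0); exact: hornerX.
    by move/eqP; rewrite polyX_eq0.
  - split=> [z /set_mem|].
      move=> [a [b [b0 a0 za]]]; apply/mem_set; exists a, b; split=> //.
      exact: hor0.
    move=> /(_ (toloc y))/= H.
    have /H/set_mem/(loc_ker_toloc hor0)/= : toloc y \in loc_max (origin p).
      by apply/loc_max_toloc; rewrite originE coefC coefX.
    by move/(etrans (esym (hornerC _ _)))/eqP; rewrite polyX_eq0.
move=> n [P [Pprime Plt]]; rewrite leqNgt; apply/negP => n2.
have Pp i : (i <= 3)%N -> prime_ideal (P i) by move=> i3; apply: Pprime; lia.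
have {}Plt i : (i < 3)%N -> [set` P i] `<` [set` P i.+1] by move=> i3; apply: Plt; lia.
have cP i : (i <= 3)%N -> prime_at_origin (contract (P i)) by move/Pp/contract_prime.
have cN i : (i < 3)%N -> ~ contract (P i.+1) `<=` contract (P i).
  move=> i3 sub; have [_] := Plt i i3; apply; apply: contract_sub sub.
    by case: (Pp i (ltnW i3)).
  by case: (Pp i.+1 i3).
have cS i : (i < 3)%N -> contract (P i) `<=` contract (P i.+1).
  by move=> i3 a; have [+ _] := Plt i i3; apply.
have nz : exists2 a, contract (P 1) a & a != 0.
  apply: contrapT => none; apply: (cN 0 isT) => a Pa.
  have [->|a0] := eqVneq a 0; last by case: none; exists a.
  by have [[]] := cP 0 isT.
have Py := prime_y (cP 1 isT) (cP 2 isT) (cS 1 isT) nz (cN 1 isT).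
have Px := prime_x (cP 1 isT) (cP 2 isT) (cS 1 isT) nz (cN 1 isT) Py.
have [_] := Plt 2 isT; apply=> z Pz; have [P3 _] := Pp 3 isT.
have : [set` loc_max (origin p)] z := ideal_sub_loc_max P3 Pz.
rewrite plane_max_gen; have [/idealr_closedP[P2 _] _] := Pp 2 isT.
by apply: gen_ideal_min => // v; rewrite !inE => /orP[]/eqP->.
Qed.

Lemma plane_regular : regular_local A 2.
Proof.
split; [exact: plane_noetherian|exact: plane_krull_dim|].
exists (loc_max (origin p)); split; first exact: loc_max_maximal.
  exact: loc_max_unique.
by exists [tuple toloc x; toloc y]; exact: plane_max_gen.
Qed.

End PlaneRegular.

(** * A family of curves *)

Section Curve.
Variables (K : comNzRingType) (l m q N : nat).
Local Notation R2 := {poly {poly K}}.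
Local Notation z := (('X^q : {poly K})%:P : R2).

(** With [z = y ^ q] and [l + m + 1 = q] this is [x ^ (q - 1)] modulo [z]; the
    factor [x ^ m + z ^ N] degenerates to [x ^ m] when [N] grows. *)
Definition curve : R2 := ('X^l + z) * ('X^m + z ^+ N).

Let term (n i j : nat) : R2 :=
  'X^(l * (n - i) + m * (n - j)) * ('X^(q * (i + N * j)) : {poly K})%:P.

Lemma curve_pow n :
  curve ^+ n = \sum_(i < n.+1) \sum_(j < n.+1) term n i j *+ ('C(n, i) * 'C(n, j)).
Proof.
rewrite exprMn !exprDn big_distrlr /=; apply: eq_bigr => i _; apply: eq_bigr => j _.
rewrite mulrnAr mulrnAl -mulrnA mulnC /term; congr (_ *+ _).
rewrite -!exprM mulrACA -exprD -exprD [X in _ = _ * X](_ : _ = z ^+ (i + N * j)) //.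
by rewrite -polyC_exp -exprM.
Qed.

(** The monomial [x ^ (m * n) * z ^ (n + 1 + N)] of the power of exponent
    [n + 1] comes only from choosing [z] in every first factor and [z ^ N] in
    exactly one of the second ones. *)
Lemma coef_curve_pow n : (0 < l)%N -> (0 < q)%N -> (m < N)%N ->
  (curve ^+ n.+1)`_(m * n)`_(q * (n.+1 + N)) = n.+1%:R.
Proof.
move=> l0 q0 mN.
have coef_term i j : (i < n.+2)%N -> (j < n.+2)%N ->
    (term n.+1 i j)`_(m * n)`_(q * (n.+1 + N)) = ((i == n.+1) && (j == 1%N))%:R.
  move=> i_lt j_lt; rewrite /term coefMC coefXn mulr_natl coefMn coefXn -mulrnA mulnb.
  congr (_%:R); rewrite eqn_pmul2l //; congr nat_of_bool.
  apply/andP/andP => [[/eqP iE /eqP jE]|[/eqP-> /eqP->]]; last first.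
    by rewrite subnn muln0 subn1 muln1; split.
  case: j j_lt iE jE => [|j] j_lt iE jE; first lia.
  have ij : (n.+1 - i = N * j)%N by lia.
  have jm : (l * (N * j) = m * j)%N by move: jE; rewrite ij subSS; nia.
  case: j {j_lt iE jE} ij jm => [|j] ij jm; last nia.
  by split; [apply/eqP; lia|].
rewrite curve_pow !coef_sum (bigD1 ord_max) //= [X in _ + X]big1 ?addr0 => [|i ne]; last first.
  rewrite !coef_sum big1 // => j _; rewrite !coefMn coef_term //.
  by move: ne; rewrite -(inj_eq val_inj) /= => /negPf->; rewrite mul0rn.
rewrite !coef_sum (bigD1 (inord 1)) //= big1 ?addr0 => [|j ne]; last first.
  rewrite !coefMn coef_term //; move: ne; rewrite -(inj_eq val_inj) /= inordK // => /negPf->.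
  by rewrite andbF mul0rn.
by rewrite !coefMn inordK // coef_term // !eqxx binn bin1 mul1n.
Qed.

Hypothesis lmq : (l + m).+1 = q.
Hypothesis N_gt0 : (0 < N)%N.

Lemma curve_mod_z : exists w, curve = 'X^(q.-1) + z * w.
Proof.
exists (('X^l + z) * z ^+ N.-1 + 'X^m).
have -> : q.-1 = (l + m)%N by rewrite -lmq.
have zN : z ^+ N = z * z ^+ N.-1 by rewrite -exprS prednK.
by rewrite /curve zN exprD; ring.
Qed.

Section FrobeniusPower.
Variables (p j : nat).
Hypothesis chK : p \in [pchar K].

Lemma curve_frobenius_pow :
  exists w, curve ^+ (p ^ j) = 'X^(q.-1 * p ^ j) + ('X^(q * p ^ j) : {poly K})%:P * w.
Proof.
have chP : p \in [pchar R2].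
  by apply: (rmorph_pchar (@polyC _)); apply: (rmorph_pchar (@polyC _)).
have [w ->] := curve_mod_z; exists (w ^+ (p ^ j)).
rewrite exprDn_pchar ?pnatX ?(pnatE _ (pcharf_prime chP)) ?chP //.
by rewrite exprMn -exprM -polyC_exp -exprM.
Qed.

(** Put [q' = p ^ j]. By the previous lemma a power [f ^ (q' + a)] of the curve
    lies in [(x ^ (q * q'), z ^ q')] as soon as [f ^ a] lies in
    [(x ^ q', z ^ q')], and for that it is enough that
    [a / q' >= 1 / m + 1 / N], because of the second factor of [f] alone. *)
Lemma curve_pow_ideal M : (p ^ j * (m * N + m + N) <= m * N * M)%N ->
  gen_ideal [:: 'X^(q * p ^ j); ('X^(q * p ^ j) : {poly K})%:P] (curve ^+ M).
Proof.
move=> le_M; have [M0|q'M] := ltnP M (p ^ j).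
  have m0 : (0 < m)%N by case: (m) le_M => //; nia.
  nia.
set q' := (p ^ j)%N in le_M q'M *; set Z := _%:P.
have {le_M} le_a : (q' * (m + N) <= m * N * (M - q'))%N.
  move: le_M; rewrite -addnA mulnDr mulnBr [(q' * (m * N))%N]mulnC leq_subRL //.
  by rewrite leq_mul2l q'M orbT.
have [w frobE] := curve_frobenius_pow.
have low : gen_ideal [:: 'X^q'; Z] (curve ^+ (M - q')).
  rewrite curve_pow; have I_ideal := gen_ideal_is_ideal [:: 'X^q'; Z].
  have sumP (F : 'I_(M - q').+1 -> R2) : (forall i, gen_ideal [:: 'X^q'; Z] (F i)) ->
      gen_ideal [:: 'X^q'; Z] (\sum_i F i).
    move=> FP; elim/big_ind: _ => //; first by case: I_ideal.
    by move=> u v; apply: is_idealD.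
  apply: (sumP) => i; apply: sumP => k; rewrite -mulr_natl; apply: is_idealM => //.
  have kM := ltn_ord k; have [big|small] := leqP q' (m * (M - q' - k)).
    rewrite /term; have := leq_trans big (leq_addl (l * (M - q' - i)) _).
    move=> /subnK <-; rewrite exprD mulrAC; apply: is_idealM => //.
    by apply/gen_ideal_mem; rewrite inE eqxx.
  have Nk : (q' <= i + N * k)%N.
    rewrite (leq_trans _ (leq_addl _ _)) // leqNgt; apply/negP => Nk.
    have aE : (M - q' = k + (M - q' - k))%N by rewrite subnKC.
    move: le_a small; rewrite {1}aE; move: (M - q' - k)%N => t le_a small.
    have m1 : (m * (N * k) <= m * q')%N by rewrite leq_mul2l ltnW ?orbT.
    have m2 : (N * (m * t) < N * q')%N by rewrite ltn_pmul2l.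
    lia.
  have -> : term (M - q') i k = 'X^(l * (M - q' - i) + m * (M - q' - k)) *
      ('X^(q * (i + N * k - q')) : {poly K})%:P * Z.
    by rewrite /term /Z -mulrA -polyCM -exprD -mulnDr subnK.
  apply: is_idealM => //.
  by apply/gen_ideal_mem; rewrite !inE eqxx orbT.
have /gen_ideal2P[a [b abE]] := low.
apply/gen_ideal2P; exists a, (b * 'X^(q.-1 * q') + w * curve ^+ (M - q')).
rewrite -{1}(subnKC q'M) exprD frobE -/q' -/Z.
have -> : 'X^(q * q') = 'X^(q.-1 * q') * 'X^q' :> R2.
  by rewrite -exprD -mulSnr prednK // -lmq.
by rewrite [_ ^+ (M - q')]abE; ring.
Qed.

Lemma coef_curve_frobenius_pow n : (0 < l)%N -> (m < N)%N -> (n.+1 + N < p ^ j)%N ->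
  (curve ^+ (p ^ j + n.+1))`_(q.-1 * p ^ j + m * n)`_(q * (n.+1 + N)) = n.+1%:R.
Proof.
move=> l0 mN nq; have q0 : (0 < q)%N by rewrite -lmq.
have [w frobE] := curve_frobenius_pow.
rewrite exprD frobE mulrDl !coefD -mulrA coefCM [X in _ + X]coefXnM.
rewrite ltn_pmul2l // nq addr0 coefXnM ltnNge leq_addr /= addKn.
exact: coef_curve_pow.
Qed.

End FrobeniusPower.

End Curve.

(** * The accumulation point *)

Lemma threshold_upper (R : realType) (m q N q' M : nat) :
    (0 < m)%N -> (0 < q)%N -> (0 < N)%N ->
    (m.+1%:R / (m * q)%:R + N%:R^-1) * (q * q')%:R <= M%:R :> R ->
  (q' * (m * N + m + N) <= m * N * M)%N.
Proof.
move=> m0 q0 N0; rewrite -(ler_nat R) !(natrM, natrD) -natr1.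
rewrite -(ltr0n R) in m0; rewrite -(ltr0n R) in N0; rewrite -(ler1n R) in q0.
have : 0 <= q'%:R :> R by rewrite ler0n.
move: m%:R N%:R q%:R q'%:R M%:R m0 N0 q0 => a b c d e a0 b0 c1 d0.
have -> : ((a + 1) / (a * c) + b^-1) * (c * d) = ((a + 1) * b + a * c) * d / (a * b).
  by field; rewrite !gt_eqF // (lt_le_trans ltr01).
rewrite ler_pdivrMr ?mulr_gt0 // => le_e.
have acd : a * d <= a * c * d.
  by rewrite -mulrA ler_pM2l // ler_peMl.
lra.
Qed.

Lemma threshold_lower (R : realType) (m q a q' : nat) :
    (0 < m)%N -> (0 < q)%N -> (1 < q * q')%N -> (q' <= m * a)%N ->
  m.+1%:R / (m * q)%:R < (q' + a)%N%:R / ((q * q')%:R - 1) :> R.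
Proof.
move=> m0 q0 qq'; rewrite -(ler_nat R) => le_ma.
have q1 : 0 < (q * q')%:R - 1 :> R by rewrite subr_gt0 ltr1n.
rewrite ltr_pdivlMr // mulrAC ltr_pdivrMr ?ltr0n ?muln_gt0 ?m0 //.
move: le_ma; rewrite !(natrM, natrD) -natr1.
rewrite -(ltr0n R) in m0; rewrite -(ltr0n R) in q0.
move: m%:R a%:R q%:R q'%:R m0 q0 => b c d g b0 d0 gbc.
have : d * g <= d * (b * c) by rewrite ler_pM2l.
lra.
Qed.

Section Thresholds.
Variables (R : realType) (p : nat) (hp : prime p).
(* What matters about [m] is that it is prime to [p], that [p < m < q - 1], and
   that [m + 1] does not divide [q]. *)
Local Notation K := 'F_p.
Local Notation R2 := {poly {poly K}}.
Local Notation toloc := (toloc (origin p)).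
Local Notation q := (p ^ 3)%N.
Local Notation m := (p.*2.+1).
Local Notation l := (p ^ 3 - p.*2.+2)%N.
Local Notation threshold := (m.+1%:R / (m * q)%:R : R).

Let l_gt0 : (0 < l)%N.
Proof. by rewrite subn_gt0 !expnS expn0; have := prime_gt1 hp; nia. Qed.

Let lmq : (l + m).+1 = q.
Proof. by move: l_gt0; lia. Qed.

Let germ N := toloc (curve K l m q N).

Lemma germ_neq0 N : (m < N)%N -> germ N != 0.
Proof.
move=> mN; apply/eqP; rewrite /germ -(toloc0 (origin p)) => /toloc_inj f0.
have q0 : (0 < q)%N by rewrite -lmq.
have := @coef_curve_pow K l m q N 0 l_gt0 q0 mN.
by rewrite expr1 f0 !coef0 => /eqP; rewrite eq_sym oner_eq0.
Qed.

Lemma germ_max N : germ N \in loc_max (origin p).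
Proof.
have q0 : (0 < q)%N by rewrite -lmq.
apply/loc_max_toloc; rewrite /curve rmorphM originE coefD coefXn coefC /=.
by rewrite (ltn_eqF l_gt0) coefD coef0 coefXn (ltn_eqF q0) addr0 mul0r.
Qed.

Lemma germ_ubound N : (0 < N)%N ->
  ubound (split_exponents R p (germ N)) (threshold + N%:R^-1).
Proof.
move=> N0; have M_ideal := (loc_max_maximal (origin p)).1.
apply: (@split_exponents_le R p (prime_gt1 hp) _ [:: toloc 'X; toloc 'X%:P] _ _ 3).
  by rewrite -plane_max_gen; case/idealr_closedP: M_ideal.
move=> E M E3 le_M; pose j := (E - 3)%N; pose q' := (p ^ j)%N.
have pE : (p ^ E = q * q')%N by rewrite -expnD subnKC.
have q0 : (0 < q)%N by rewrite -lmq.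
have q'0 : (0 < q')%N by rewrite expn_gt0 prime_gt0.
have in_ideal := @curve_pow_ideal K l m q N lmq N0 p j (pchar_Fp hp) M.
have /in_ideal : (q' * (m * N + m + N) <= m * N * M)%N.
  by apply: (threshold_upper (R := R) _ q0) => //; rewrite -pE.
rewrite -pE => /gen_ideal2P[a [b fE]]; apply/gen_ideal2P.
exists (toloc a), (toloc b); rewrite /germ -tolocXn fE tolocD !tolocM.
by rewrite -!tolocXn polyC_exp.
Qed.

(** Since [m] is prime to [p], some power of [p] has the form
    [p ^ k = 1 + m * r] with [r] large. The exponent [a = p * r + 1] satisfies
    [m * a >= p * p ^ k], which puts the quotient above the threshold, while
    [a = 1] modulo [p] keeps the relevant coefficient from vanishing. *)
Lemma germ_exponent N : (m < N)%N ->
  exists2 s, split_exponents R p (germ N) s & threshold < s.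
Proof.
move=> mN; have p1 := prime_gt1 hp.
have com : coprime p m.
  by rewrite prime_coprime // -addn1 dvdn_addr -?muln2 ?dvdn_mulr // dvdn1; lia.
pose k := (totient m * (m * N))%N.
have pk1 : p ^ k = 1 %[mod m].
  by rewrite expnM -modnXm Euler_exp_totient // modnXm exp1n.
have k_ge : (m * N < p ^ k)%N.
  apply: leq_ltn_trans (ltn_expl k p1); rewrite leq_pmull // totient_gt0 //.
have [r rE] : exists r, (p ^ k = 1 + m * r)%N.
  exists (p ^ k %/ m)%N; rewrite {1}(divn_eq (p ^ k) m) pk1 modn_small; last first.
    by rewrite ltnS double_gt0 prime_gt0.
  by rewrite addnC mulnC.
have rN : (N <= r)%N by rewrite -(leq_pmul2l (ltn0Sn p.*2)); lia.
pose a := (p * r).+1; pose e := (3 + k.+1)%N.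
have pe : (p ^ e = q * p ^ k.+1)%N by rewrite expnD.
have q'E : (p ^ k.+1 = p + m * (p * r))%N by rewrite expnS rE mulnDr muln1 mulnCA.
have coef := @coef_curve_frobenius_pow K l m q N lmq (ltn_trans (ltn0Sn _) mN) p k.+1
  (pchar_Fp hp) (p * r) l_gt0 mN.
have aN : (a + N < p ^ k.+1)%N by rewrite q'E /a; nia.
have q0 : (0 < q)%N by rewrite -lmq.
have [|||psi psi_lin psi1] := @plane_splitting p hp e (q.-1 * p ^ k.+1 + m * (p * r))
    (q * (a + N)) (curve K l m q N ^+ (p ^ k.+1 + a)).
- by rewrite pe -{2}(prednK q0) mulSn [X in (_ < X)%N]addnC ltn_add2l q'E; lia.
- by rewrite pe ltn_pmul2l.
- by rewrite coef // -natr1 natrM pchar_Fp_0 // mul0r add0r oner_neq0.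
exists ((p ^ k.+1 + a)%N%:R / ((p ^ e)%:R - 1)).
  by apply: (split_exponents_mem R p1 _ psi_lin); rewrite // /germ -tolocXn.
rewrite pe; apply: threshold_lower => //; last by rewrite q'E /a; lia.
by rewrite -pe -(expn0 p) ltn_exp2l.
Qed.

Lemma fpt_germ N : (m < N)%N ->
  exists t, [/\ fpt_set R 2 p t, threshold < t & t <= threshold + N%:R^-1].
Proof.
move=> mN; have ub := germ_ubound (ltn_trans (ltn0Sn _) mN).
have [s sS lt_s] := germ_exponent mN.
exists (fpt R (pchar_plane hp) (germ N)); rewrite fptE ?germ_neq0 //; split.
- exists (loc (origin p)), (pchar_plane hp), (germ N); split.
  + exact: plane_F_finite.
  + exact: plane_regular.
  + apply/eqP => /gen_ideal_unit[w w1].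
    have /idealr_closedP[M_ideal M1] := (loc_max_maximal (origin p)).1.
    by apply: M1; rewrite -w1; apply: is_idealM M_ideal (germ_max N).
  + by rewrite fptE ?germ_neq0.
- by apply: lt_le_trans lt_s _; apply: ub_le_sup sS; eexists; exact: ub.
- by apply: ge_sup ub; exists s.
Qed.

(** [threshold = 1 / n] would make [m + 1], which is prime to [m], a divisor of
    [q = p ^ 3]; but [m + 1 = 2 * (p + 1)]. *)
Lemma threshold_notin_fpt_set1 : ~ fpt_set R 1 p threshold.
Proof.
have q0 : (0 < q)%N by rewrite -lmq.
have mq0 : (m * q)%:R != 0 :> R by rewrite pnatr_eq0 -lt0n muln_gt0.
move=> /(fpt_set1 hp)[/eqP|[n n0 /eqP]].
  by rewrite mulf_eq0 invr_eq0 (negPf mq0) pnatr_eq0.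
have nR : n%:R != 0 :> R by rewrite pnatr_eq0 -lt0n.
rewrite -[n%:R^-1]mul1r eqr_div // mul1r -natrM eqr_nat => /eqP mnE.
have : (m.+1 %| m * q)%N by rewrite -mnE dvdn_mulr.
rewrite Gauss_dvdr ?coprimeSn // => m_q.
have : (p.+1 %| q)%N by apply: dvdn_trans m_q; rewrite -doubleS -muln2 dvdn_mulr.
rewrite -[q]muln1 Gauss_dvdr ?dvdn1; first by have := prime_gt1 hp; lia.
by rewrite coprimeXr ?coprimeSn.
Qed.

End Thresholds.

Theorem theorem1p3 (R : realType) (p : nat) (hp : prime p) :
  exists t : rat,
    (limit_point (fpt_set R 2 p) `\` fpt_set R 1 p) (ratr t).
Proof.
exists (p.*2.+2%:R / (p.*2.+1 * p ^ 3)%:R); rewrite fmorph_div /= !ratr_nat.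
split; last exact: threshold_notin_fpt_set1.
move=> U /nbhs_ballP[eps /= eps0 epsU].
pose N := (p.*2.+1 + Num.bound eps^-1).+1.
have [|t [tS lt_t t_le]] := @fpt_germ R p hp N; first by rewrite ltnS leq_addr.
exists t; split=> //; first by rewrite gt_eqF.
apply: epsU; rewrite /ball /= ltr_distlC.
have N_eps : N%:R^-1 < eps.
  rewrite invf_plt ?posrE ?ltr0n //; apply: lt_le_trans (archi_boundP _) _.
    by rewrite invr_ge0 ltW.
  by rewrite ler_nat /N ltnW // ltnS leq_addl.
move: lt_t t_le N_eps; set c := _ / _; move: c N%:R^-1 => c d lt_t t_le d_eps.
by apply/andP; split; lra.
Qed.
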